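(* Let $\Omega\subset\mathbb R^N$ be a bounded and convex domain, let $\mu\in\mathcal P(\Omega\times\{0,1\})$ be a probability measure, and let $\varrho_i:=\mu(\,\cdot\,\times\{i\})$ for $i=0,1$ be such that $\varrho_0,\varrho_1$ are absolutely continuous with respect to the Lebesgue measure (with densities again denoted $\varrho_0,\varrho_1$). Then for every $u\in L^\infty(\Omega)$ $$\mathrm{TV}_\varepsilon(u)=\sup_{\boldsymbol\Psi\in\mathfrak P\times\mathfrak P}\int_\Omega\int_\Omega\mathrm{grad}_\varepsilon[u](x,y)\,[\boldsymbol\Psi;\boldsymbol\varrho](x,y)\,\mathrm dy\,\mathrm dx=\sup_{\boldsymbol\Psi\in\mathfrak P\times\mathfrak P}-\int_\Omega u(y)\,\mathrm{div}_\varepsilon[\boldsymbol\Psi;\boldsymbol\varrho](y)\,\mathrm dy.$$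
   Context: Fix $\varepsilon>0$; $\mathrm B_\varepsilon(x)=\{y\in\mathbb R^N:|x-y|<\varepsilon\}$ with closure $\overline{\mathrm B}_\varepsilon(x)$. All a.e./ess notions are with respect to Lebesgue measure. $$\mathrm{TV}_\varepsilon(u)=\int_\Omega\frac{\operatorname{ess\,sup}_{\mathrm B_\varepsilon(x)\cap\Omega}u-u(x)}{\varepsilon}\varrho_0(x)\,\mathrm dx+\int_\Omega\frac{u(x)-\operatorname{ess\,inf}_{\mathrm B_\varepsilon(x)\cap\Omega}u}{\varepsilon}\varrho_1(x)\,\mathrm dx.$$ $\mathfrak P$ is the set of $\Psi\in L^1(\Omega\times\Omega)$ with $\Psi\ge0$ a.e. on $\Omega\times\Omega$ and (for a representative) $\int_\Omega\Psi(x,y)\,\mathrm dy=1$ and $\operatorname{ess\,supp}\Psi(x,\cdot)\subset\overline{\mathrm B}_\varepsilon(x)\cap\overline\Omega$ for $x\in\Omega$. $\mathrm{grad}_\varepsilon[u](x,y)=\frac{u(y)-u(x)}{\varepsilon}$. For $f\in L^1(\Omega\times\Omega)$, $\mathrm{div}_\varepsilon[f](y)=\int_{\mathrm B_\varepsilon(y)\cap\Omega}\frac{f(y,x)-f(x,y)}{\varepsilon}\,\mathrm dx$. For $\boldsymbol\Psi=(\Psi_0,\Psi_1)$ and $\boldsymbol\varrho=(\varrho_0,\varrho_1)$, $[\boldsymbol\Psi;\boldsymbol\varrho](x,y):=\Psi_0(x,y)\varrho_0(x)-\Psi_1(x,y)\varrho_1(x)$, and $\mathrm{div}_\varepsilon[\boldsymbol\Psi;\boldsymbol\varrho]$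 means $\mathrm{div}_\varepsilon$ applied to this function. *)

(* Defs.v *)
From HB Require Import structures.
From mathcomp Require Import all_boot all_order all_algebra.
From mathcomp Require Import all_classical all_reals all_analysis.
From mathcomp Require Import measurable_realfun ess_sup_inf.

Set Implicit Arguments.
Unset Strict Implicit.
Unset Printing Implicit Defensive.

Import Order.TTheory GRing.Theory Num.Theory.
Import numFieldNormedType.Exports.

Local Open Scope classical_set_scope.
Local Open Scope ring_scope.

Definition measure_rV_display : measure_display.
Proof. exact. Qed.

Section borel_rV.
Context {R : realType} (n : nat).

Let borel0 : <<s @open 'rV[R]_n >> set0.
Proof. exact: sigma_algebra0. Qed.

Let borelC (A : set 'rV[R]_n) : <<s open >> A -> <<s open >> (~` A).
Proof. exact: sigma_algebraC. Qed.

Let borelU (F : (set 'rV[R]_n)^nat) : (forall i, <<s open >> (F i)) ->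
  <<s open >> (\bigcup_i F i).
Proof. exact: sigma_algebra_bigcup. Qed.

HB.instance Definition _ := @isMeasurable.Build measure_rV_display 'rV[R]_n
  <<s open >> borel0 borelC borelU.

Lemma open_measurable_rV (U : set 'rV[R]_n) : open U -> measurable U.
Proof. exact: sub_sigma_algebra. Qed.

Lemma measurable_coord (i : 'I_n) :
  measurable_fun setT (fun x : 'rV[R]_n => x ord0 i).
Proof.
apply: (measurability _ (RGenOpens.measurableE R)).
move=> _ [_ [a [b ->]] <-]; rewrite setTI; apply: open_measurable_rV.
apply: (@open_comp _ R^o); last exact: interval_open.
by move=> x _; exact: coord_continuous.
Qed.

Lemma measurable_fun_rV d (T : measurableType d) (f : T -> 'rV[R]_n) :
  (forall i, measurable_fun setT (fun x => f x ord0 i)) -> measurable_fun setT f.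
Proof.
move=> mf; apply: (measurability (@open 'rV[R]_n)) => //.
move=> _ [U oU <-]; rewrite setTI.
pose q (z : 'rV[rat]_n * nat) : 'rV[R]_n := map_mx ratr z.1.
pose r (z : 'rV[rat]_n * nat) : R := z.2.+1%:R^-1.
pose B z := \bigcap_(i in [set: 'I_n])
  ((fun t => f t ord0 i) @^-1` ball (q z ord0 i) (r z)).
have mB z : measurable (B z).
  apply: fin_bigcap_measurable; first exact: finite_finset.
  move=> i _; rewrite -[X in measurable X]setTI; apply: mf => //.
  exact: measurable_ball.
pose J := [set z | ball (q z) (r z) `<=` U].
suff -> : f @^-1` U = \bigcup_(z in J) B z.
  rewrite bigcup_mkcond; apply: countable_bigcupT_measurable => // z.
  by case: ifP.
apply/seteqP; split => [t Ut|t [z zJ Bz]]; last first.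
  by apply: zJ; split; [rewrite invr_gt0|move=> i j; rewrite (ord1 i); exact: Bz].
have /nbhs_ballP[e /= e0 etU] : nbhs (f t) U by exact: open_nbhs_nbhs.
have [k ke] : exists k : nat, k.+1%:R^-1 < e / 2.
  have [k _ /(_ k (leqnn k))] := near_infty_natSinv_lt (PosNum (divr_gt0 e0 (ltr0Sn R 1))).
  by exists k.
have k0 : 0 < k.+1%:R^-1 :> R by rewrite invr_gt0.
have dq i : {a : rat | `|ratr a - f t ord0 i| < k.+1%:R^-1}.
  apply: cid.
  have /rat_in_itvoo[a] : f t ord0 i < f t ord0 i + k.+1%:R^-1 by rewrite ltrDl.
  rewrite in_itv/= => /andP[a1 a2]; exists a.
  by rewrite ger0_norm ?subr_ge0 ?ltW// ltrBlDl.
pose z : 'rV[rat]_n * nat := (\row_i sval (dq i), k).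
exists z.
  move=> y [_ zy]; apply: etU; split => // i j.
  rewrite (ord1 i); apply: (@ball_splitr _ _ (q z ord0 j)); last first.
    exact: (le_ball (ltW ke) (zy ord0 j)).
  rewrite /q !mxE; apply: (le_ball (ltW ke)); exact: (svalP (dq j)).
by move=> i _; rewrite /= /q !mxE; exact: (svalP (dq i)).
Qed.

End borel_rV.

Section lebesgue_rV.
Context {R : realType}.

Definition rV_cons n (p : R * 'rV[R]_n) : 'rV[R]_n.+1 :=
  row_mx (const_mx p.1 : 'rV_1) p.2.

Lemma rV_cons0 n (p : R * 'rV[R]_n) : rV_cons p ord0 ord0 = p.1.
Proof.
rewrite /rV_cons (_ : ord0 = lshift n (ord0 : 'I_1)); last exact/val_inj.
by rewrite [LHS]row_mxEl mxE.
Qed.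

Lemma rV_consS n (p : R * 'rV[R]_n) (i : 'I_n) :
  rV_cons p ord0 (lift ord0 i) = p.2 ord0 i.
Proof.
rewrite /rV_cons (_ : lift ord0 i = rshift 1 i); last exact/val_inj.
by rewrite [LHS]row_mxEr.
Qed.

Lemma measurable_rV_cons n : measurable_fun setT (@rV_cons n).
Proof.
apply: measurable_fun_rV => i; case: (unliftP ord0 i) => [j ->|->].
  under eq_fun do rewrite rV_consS.
  exact: measurableT_comp (measurable_coord j) measurable_snd.
by under eq_fun do rewrite rV_cons0; exact: measurable_fst.
Qed.

Definition rV_uncons n (x : 'rV[R]_n.+1) : R * 'rV[R]_n :=
  (x ord0 ord0, rsubmx (x : 'rV_(1 + n))).

Lemma rV_consK n : cancel (@rV_cons n) (@rV_uncons n).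
Proof.
by case=> t x; rewrite /rV_uncons rV_cons0 /rV_cons row_mxKr.
Qed.

Lemma measurable_rV_uncons n : measurable_fun setT (@rV_uncons n).
Proof.
apply: measurable_fun_pair; first exact: measurable_coord.
by apply: measurable_fun_rV => i; under eq_fun do rewrite mxE; exact: measurable_coord.
Qed.

Section step.
Context n (mu : {sigma_finite_measure set 'rV[R]_n -> \bar R}).

Definition lebesgue_rV_step : set 'rV[R]_n.+1 -> \bar R :=
  pushforward (@lebesgue_measure R \x mu)%E (@rV_cons n).

Let step_meas : {measure set 'rV[R]_n.+1 -> \bar R} :=
  measure_function_pushforward__canonical__measure_function_Measure
    (@lebesgue_measure R \x mu)%E (@measurable_rV_cons n).

Let step0 : lebesgue_rV_step set0 = 0%E.
Proof. exact: (measure0 step_meas). Qed.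

Let step_ge0 A : (0 <= lebesgue_rV_step A)%E.
Proof. exact: (measure_ge0 step_meas). Qed.

Let step_sigma_additive : semi_sigma_additive lebesgue_rV_step.
Proof. exact: (@measure_semi_sigma_additive _ _ _ step_meas). Qed.

HB.instance Definition _ := isMeasure.Build _ _ _ lebesgue_rV_step
  step0 step_ge0 step_sigma_additive.

Let step_sigma_finite : sigma_finite setT lebesgue_rV_step.
Proof.
have /sigma_finiteP[F [FT ndF Foo]] := sigma_finiteT (@lebesgue_measure R).
have /sigma_finiteP[G [GT ndG Goo]] := sigma_finiteT mu.
exists (fun k => @rV_uncons n @^-1` (F k `*` G k)) => [|k].
  apply/esym; rewrite -subTset => x _.
  have [i _ Fi] : (\bigcup_i F i) (rV_uncons x).1 by rewrite -FT.
  have [j _ Gj] : (\bigcup_i G i) (rV_uncons x).2 by rewrite -GT.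
  exists (maxn i j) => //; split.
    by move: Fi; exact/subsetPset/ndF/leq_maxl.
  by move: Gj; exact/subsetPset/ndG/leq_maxr.
have [[mF Fk] [mG Gk]] := (Foo k, Goo k); split.
  rewrite -[X in measurable X]setTI.
  by apply: measurable_rV_uncons => //; exact: measurableX.
rewrite /lebesgue_rV_step /pushforward -comp_preimage.
rewrite (_ : _ \o _ = id) ?preimage_id; last exact/funext/rV_consK.
by rewrite product_measure1E// lte_mul_pinfty// ge0_fin_numE.
Qed.

HB.instance Definition _ := Measure_isSigmaFinite.Build _ _ _ lebesgue_rV_step
  step_sigma_finite.

End step.

Fixpoint lebesgue_rV n : {sigma_finite_measure set 'rV[R]_n -> \bar R} :=
  if n is n'.+1 then lebesgue_rV_step (lebesgue_rV n') else \d_(0 : 'rV[R]_0).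

Lemma lebesgue_rV_box n (A : 'I_n -> set R) : (forall i, measurable (A i)) ->
  lebesgue_rV n [set x | forall i, A i (x ord0 i)] =
  (\prod_(i < n) @lebesgue_measure R (A i))%E.
Proof.
elim: n A => [A mA|n IH A mA].
  by rewrite big_ord0 /= diracE mem_set//= => -[].
rewrite big_ord_recl -IH; last by move=> i; exact: mA.
have mB : measurable [set x : 'rV[R]_n | forall i, A (lift ord0 i) (x ord0 i)].
  rewrite (_ : mkset _ = \bigcap_(i in [set: 'I_n])
      ((fun x : 'rV[R]_n => x ord0 i) @^-1` A (lift ord0 i))); last first.
    by apply/seteqP; split => x /= Ax i; [move=> _; exact: Ax|exact: Ax].
  apply: fin_bigcap_measurable; first exact: finite_finset.
  by move=> i _; rewrite -[X in measurable X]setTI; exact: measurable_coord.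
rewrite -product_measure1E//=; last exact: (mA ord0).
rewrite /lebesgue_rV_step /pushforward.
congr (product_measure1 lebesgue_measure (lebesgue_rV n) _).
apply/seteqP; split => -[t x] /= h.
  split => [|i]; first by have := h ord0; rewrite rV_cons0.
  by have := h (lift ord0 i); rewrite rV_consS.
case: h => h0 h i; case: (unliftP ord0 i) => [j ->|->].
  by rewrite rV_consS.
by rewrite rV_cons0.
Qed.

End lebesgue_rV.

Section nonlocal_tv.
Context {R : realType} {N : nat}.
Local Notation T := 'rV[R]_N.
Local Notation leb := (@lebesgue_rV R N).
Implicit Types (Omega D : set T) (u g : T -> R) (f Psi : T * T -> R).

(* The library norm on 'rV[R]_N is the sup norm, which induces the usual
   topology but not the Euclidean balls. *)
Definition enorm (x : T) : R := Num.sqrt (\sum_(i < N) x ord0 i ^+ 2).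

Definition eball (x : T) (eps : R) : set T := [set y | enorm (x - y) < eps].

Definition domain Omega : Prop :=
  [/\ open Omega, Omega !=set0 & connected Omega].

Definition ess_sup_on D (h : T -> \bar R) : \bar R :=
  ereal_inf [set y | \forall x \ae leb, D x -> (h x <= y)%E].

Definition ess_inf_on D (h : T -> \bar R) : \bar R :=
  ereal_sup [set y | \forall x \ae leb, D x -> (y <= h x)%E].

Lemma ess_sup_onE D (mD : measurable D) (h : T -> \bar R) :
  ess_sup_on D h = ess_sup (mrestr leb mD) h.
Proof.
congr ereal_inf; apply/seteqP; split => y [A [mA A0 hA]].
  exists (A `|` ~` D); split; first by apply: measurableU => //; exact: measurableC.
    change (leb ((A `|` ~` D) `&` D) = 0%E); rewrite setIUl setICl setU0.
    apply/eqP; rewrite -measure_le0 -A0 le_measure ?inE//.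
    exact: measurableI.
  by move=> x /= xy; have [Dx|] := pselect (D x); [left; apply: hA => /= /(_ Dx)|right].
exists (A `&` D); split => //; first exact: measurableI.
move=> x /= /not_implyP[Dx xy]; split => //; exact: hA.
Qed.

Definition Linfty Omega u : Prop :=
  measurable_fun Omega u /\ (ess_sup_on Omega (fun x => `|u x|%:E) < +oo)%E.

(* Complement of the largest open set on which g vanishes a.e. in D. *)
Definition ess_supp D g : set T :=
  ~` \bigcup_(U in [set U | open U /\
        \forall x \ae leb, U x -> D x -> g x = 0]) U.

(* Psi stands for its class in L^1(Omega x Omega): the pointwise conditions
   bear on a representative Phi, the sign condition on the class. *)
Definition admissible Omega (eps : R) : set (T * T -> R) :=
  [set Psi | [/\ (leb \x leb)%E.-integrable (Omega `*` Omega) (EFin \o Psi),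
    \forall z \ae (leb \x leb)%E, (Omega `*` Omega) z -> 0 <= Psi z &
    exists Phi : T * T -> R, [/\ measurable_fun (Omega `*` Omega) Phi,
      \forall z \ae (leb \x leb)%E, (Omega `*` Omega) z -> Phi z = Psi z &
      forall x, Omega x ->
        (\int[leb]_(y in Omega) (Phi (x, y))%:E = 1)%E /\
        ess_supp Omega (fun y => Phi (x, y)) `<=`
          closure (eball x eps) `&` closure Omega]]].

(* The label set {0, 1} is bool, with 0 = false and 1 = true. *)
Definition marginal (mu : set (T * bool) -> \bar R) (i : bool) : set T -> \bar R :=
  fun A => mu (A `*` [set i]).

Definition is_density Omega (nu : set T -> \bar R) g : Prop :=
  leb.-integrable Omega (EFin \o g) /\
  forall A, measurable A -> A `<=` Omega ->
    nu A = (\int[leb]_(x in A) (g x)%:E)%E.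

Definition TV_eps Omega (eps : R) (rho : (T -> R) * (T -> R)) u : \bar R :=
  (\int[leb]_(x in Omega)
     ((ess_sup_on (eball x eps `&` Omega) (EFin \o u) - (u x)%:E)
        * eps^-1%:E * (rho.1 x)%:E)
   + \int[leb]_(x in Omega)
     (((u x)%:E - ess_inf_on (eball x eps `&` Omega) (EFin \o u))
        * eps^-1%:E * (rho.2 x)%:E))%E.

Definition grad_eps (eps : R) u : T * T -> R := fun z => (u z.2 - u z.1) / eps.

Definition div_eps Omega (eps : R) f : T -> \bar R := fun y =>
  (\int[leb]_(x in eball y eps `&` Omega) ((f (y, x) - f (x, y)) / eps)%:E)%E.

Definition bracket (Psi : (T * T -> R) * (T * T -> R))
    (rho : (T -> R) * (T -> R)) : T * T -> R :=
  fun z => Psi.1 z * rho.1 z.1 - Psi.2 z * rho.2 z.1.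

End nonlocal_tv.

(* Main.v *)
Require Import Defs.
From HB Require Import structures.
From mathcomp Require Import all_boot all_order all_algebra.
From mathcomp Require Import all_classical all_reals all_analysis.
From mathcomp Require Import measurable_realfun ess_sup_inf.
From mathcomp Require Import lra.

(** An admissible kernel [Psi] makes [Psi (x, _)] a probability density carried
by the ball of centre [x] (spheres are null, so closed and open balls agree).
Averaging [u] against it gives at most the essential supremum over the ball,
and at least that supremum up to [k] when [Psi (x, _)] is the uniform density
on the part of the ball where [u] exceeds the supremum minus [k]; these sets
depend measurably on [x].  Since the essential infimum of [u] is minus the
essential supremum of [- u], the two halves of the total variation are both of
this form and are treated separately.  The divergence pairing equals the
gradient pairing for each kernel, by Fubini's theorem and the exchange of the
two variables.

All integrals are computed with everywhere-defined representatives: [v] bounded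
for [u], [r] nonnegative for a density [rho], [P] for [Psi]. *)

Set Implicit Arguments.
Unset Strict Implicit.

Import Order.TTheory GRing.Theory Num.Theory.
Import numFieldNormedType.Exports.

Local Open Scope classical_set_scope.
Local Open Scope ring_scope.

(** * Product measures *)

Section product_measure_ae.
Local Open Scope ereal_scope.
Context d1 d2 (T1 : measurableType d1) (T2 : measurableType d2) (R : realType).
Variables (m1 : {sigma_finite_measure set T1 -> \bar R}).
Variables (m2 : {sigma_finite_measure set T2 -> \bar R}).

Lemma ae_measure0 d (T : measurableType d) (m : {measure set T -> \bar R})
    (g : T -> \bar R) : measurable_fun setT g -> (forall x, 0 <= g x) ->
  \int[m]_x g x = 0 <-> {ae m, forall x, g x = 0}.
Proof.
move=> mg g0; have := (ae_eq_integral_abs m measurableT mg).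
under eq_integral do rewrite gee0_abs//.
move=> ->; split; apply: filterS => x /=; first exact.
by move=> + _.
Qed.

(** The product measure is defined as the integral of the section measures, a nonnegative function,
    so [ae_measure0] applies. *)
Lemma product_measure_null (W : set (T1 * T2)) : measurable W ->
  (m1 \x m2) W = 0 <-> {ae m1, forall x, m2 (xsection W x) = 0}.
Proof.
move=> mW; apply: ae_measure0 => //; exact: measurable_fun_xsection.
Qed.

(** Both orders of integration define a measure with the same values on rectangles, and such a
    measure is unique. *)
Lemma product_measure_ysection (W : set (T1 * T2)) : measurable W ->
  (m1 \x m2) W = \int[m2]_y m1 (ysection W y).
Proof.
move=> mW; rewrite (@product_measure_unique _ _ _ _ _ _ _ (m1 \x^ m2))//.
by move=> A B mA mB; rewrite -product_measure2E.
Qed.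

Lemma ae_xsection (P : T1 * T2 -> Prop) : {ae m1 \x m2, forall z, P z} ->
  {ae m1, forall x, {ae m2, forall y, P (x, y)}}.
Proof.
move=> [B [mB B0 PB]]; have := (product_measure_null mB).1 B0.
apply: filterS => x Bx; exists (xsection B x); split => //.
  exact: measurable_xsection.
by move=> y /= Pxy; rewrite /xsection/= inE; exact: PB.
Qed.

(** Tonelli's theorem gives measurability for the positive and negative parts, and the integral is
    by definition their difference; [f] may have any sign and need not be integrable. *)
Lemma measurable_fun_integral_snd (f : T1 * T2 -> \bar R) :
  measurable_fun setT f -> measurable_fun setT (fun x => \int[m2]_y f (x, y)).
Proof.
move=> mf; rewrite (_ : (fun _ => _) = (fun x => \int[m2]_y f^\+ (x, y)) \-
    (fun x => \int[m2]_y f^\- (x, y))).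
  apply: emeasurable_funB.
    apply: (measurable_fun_fubini_tonelli_F f^\+) => //.
    exact: measurable_funepos.
  apply: (measurable_fun_fubini_tonelli_F f^\-) => //.
  exact: measurable_funeneg.
apply/funext => x; rewrite [LHS]integralE.
under eq_integral do rewrite funepos_comp/=.
by under [X in _ - X = _]eq_integral do rewrite funeneg_comp/=.
Qed.

Lemma ae_eq_integral_snd (f g : T1 * T2 -> \bar R) :
  measurable_fun setT f -> measurable_fun setT g ->
  {ae m1 \x m2, forall z, f z = g z} ->
  {ae m1, forall x, \int[m2]_y f (x, y) = \int[m2]_y g (x, y)}.
Proof.
move=> mf mg /ae_xsection; apply: filterS => x fg.
apply: ae_eq_integral => //; try exact: measurableT_comp.
by apply: filterS fg => y + _.
Qed.

(** Fubini's theorem for a function [f] controlled only on a rectangle and up to a null set. It is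
    the passage from given functions to their representatives. *)
Lemma integral_iterated_ae D1 D2 (f g : T1 * T2 -> \bar R) :
  measurable D1 -> measurable D2 -> measurable_fun (D1 `*` D2) f ->
  (m1 \x m2).-integrable setT g -> (forall z, ~ (D1 `*` D2) z -> g z = 0) ->
  {ae m1 \x m2, forall z, (D1 `*` D2) z -> f z = g z} ->
  \int[m1]_(x in D1) \int[m2]_(y in D2) f (x, y) = \int[m1 \x m2]_z g z.
Proof.
move=> mD1 mD2 mf ig g0 fg.
have mD : measurable (D1 `*` D2) by exact: measurableX.
have mf' : measurable_fun setT (f \_ (D1 `*` D2)) by exact/(measurable_restrictT f mD).
have mg : measurable_fun setT g by exact: measurable_int ig.
(* Cutting [f] to zero off the rectangle makes it measurable everywhere and almost everywhere equal
   to [g]. *)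
transitivity (\int[m1]_x \int[m2]_y (f \_ (D1 `*` D2)) (x, y)).
  rewrite integral_mkcond; apply: eq_integral => x _; rewrite patchE.
  case: ifPn => xD1.
    rewrite integral_mkcond; apply: eq_integral => y _.
    by rewrite !patchE in_setX/= xD1.
  by rewrite integral0_eq// => y _; rewrite patchE in_setX/= (negbTE xD1).
rewrite -integral12_prod_meas1//; apply: ae_eq_integral => //.
- exact: measurable_fun_integral_snd.
- exact: measurable_fun_integral_snd.
have : {ae m1 \x m2, forall z, (f \_ (D1 `*` D2)) z = g z}.
  apply: filterS fg => z fgz; rewrite patchE; case: ifPn => [|/negP].
    by rewrite inE.
  by rewrite inE => /g0 ->.
move/ae_eq_integral_snd => /(_ mf' mg); apply: filterS => x + _; exact.
Qed.

End product_measure_ae.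

(** * Exchange of the two variables *)

Section product_measure_swap.
Local Open Scope ereal_scope.
Context d (T : measurableType d) (R : realType).
Variable (m : {sigma_finite_measure set T -> \bar R}).

Lemma ae_swap (P : T * T -> Prop) : {ae m \x m, forall z, P z} ->
  {ae m \x m, forall z, P (z.2, z.1)}.
Proof.
move=> [B [mB B0 PB]].
have mB' : measurable ((fun z : T * T => (z.2, z.1)) @^-1` B).
  by rewrite -[X in measurable X]setTI; exact: measurable_swap.
exists ((fun z : T * T => (z.2, z.1)) @^-1` B); split => //; last first.
  by move=> z /= Pz; exact: PB.
(* The sections of the exchanged set along the second variable are the sections of [B] along the
   first. *)
by rewrite product_measure_ysection// -[RHS]B0.
Qed.

(** Integrability is finiteness of an iterated integral of the absolute value, in either order. *)
Lemma integrable_swap (f : T * T -> \bar R) : (m \x m).-integrable setT f ->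
  (m \x m).-integrable setT (fun z => f (z.2, z.1)).
Proof.
move=> fi; have mf : measurable_fun setT f by exact: measurable_int fi.
apply/integrable21ltyP; last exact/integrable12ltyP.
exact: (measurableT_comp mf (@measurable_swap _ _ T T)).
Qed.

Lemma integral_swap (f : T * T -> \bar R) : (m \x m).-integrable setT f ->
  \int[m \x m]_z f (z.2, z.1) = \int[m \x m]_z f z.
Proof.
move=> fi; rewrite -[RHS]integral12_prod_meas1// -integral21_prod_meas1//.
exact: integrable_swap.
Qed.

End product_measure_swap.

(** Converse of [ae_xsection]; measurability of [P] allows the measure of its complement to be
    computed from the sections. *)
Lemma ae_product d1 d2 (T1 : measurableType d1) (T2 : measurableType d2)
    (R : realType) (m1 : {sigma_finite_measure set T1 -> \bar R})
    (m2 : {sigma_finite_measure set T2 -> \bar R}) (P : set (T1 * T2)) :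
  measurable P -> {ae m1, forall x, {ae m2, forall y, P (x, y)}} ->
  {ae m1 \x m2, forall z, P z}%E.
Proof.
move=> mP aeP; have mC : measurable (~` P) by exact: measurableC.
exists (~` P); split => //; apply/product_measure_null => //.
apply: filterS aeP => x Px; apply: measure_negligible.
  exact: measurable_xsection.
by apply: negligibleS Px => y; rewrite /xsection/= inE.
Qed.

Section ae_projections.
Context d1 d2 (T1 : measurableType d1) (T2 : measurableType d2) (R : realType).
Variables (m1 : {sigma_finite_measure set T1 -> \bar R}).
Variables (m2 : {sigma_finite_measure set T2 -> \bar R}).

Lemma ae_fst (P : T1 -> Prop) : {ae m1, forall x, P x} ->
  {ae m1 \x m2, forall z, P z.1}%E.
Proof.
move=> [A [mA A0 PA]]; exists (A `*` setT); split; first exact: measurableX.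
  by rewrite product_measure1E// [X in (X * _)%E]A0 mul0e.
by move=> z /= Pz; split => //; exact: PA.
Qed.

Lemma ae_snd (P : T2 -> Prop) : {ae m2, forall x, P x} ->
  {ae m1 \x m2, forall z, P z.2}%E.
Proof.
move=> [A [mA A0 PA]]; exists (setT `*` A); split; first exact: measurableX.
  by rewrite product_measure1E// [X in (_ * X)%E]A0 mule0.
by move=> z /= Pz; split => //; exact: PA.
Qed.

End ae_projections.

Lemma integrable_bounded_mul d (T : measurableType d) (R : realType)
    (m : {measure set T -> \bar R}) (w f : T -> R) (C : R) :
  measurable_fun setT w -> (forall x, `|w x| <= C) ->
  m.-integrable setT (EFin \o f) -> m.-integrable setT (fun x => (w x * f x)%:E).
Proof.
move=> mw wC fi; have mf : measurable_fun setT f.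
  by apply/measurable_EFinP; exact: measurable_int fi.
apply: le_integrable (integrableZl measurableT C (integrable_abse fi)) => //.
  exact/measurable_EFinP/measurable_funM.
move=> x _; rewrite /= lee_fin !normrM normr_id.
by apply: ler_wpM2r => //; apply: le_trans (ler_norm _); exact: wC.
Qed.

(** * Euclidean balls and Lebesgue measure *)

Section euclidean_balls.
Context {R : realType}.

(** The squared Euclidean distance is polynomial in the coordinates, and comparing it with [r ^+ 2]
    describes balls without a square root. *)
Definition sqdist {n} (x y : 'rV[R]_n) : R := \sum_(i < n) (x - y) ord0 i ^+ 2.

Lemma sqdistC n (x y : 'rV[R]_n) : sqdist x y = sqdist y x.
Proof. by apply: eq_bigr => i _; rewrite !mxE -sqrrN opprB. Qed.

Lemma eballE n (x y : 'rV[R]_n) (r : R) : 0 < r ->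
  eball x r y = (sqdist x y < r ^+ 2).
Proof.
move=> r0; rewrite /eball/= /enorm -[X in _ < X](gtr0_norm r0) -sqrtr_sqr.
by rewrite ltr_sqrt// exprn_gt0.
Qed.

Lemma measurable_sqdist n :
  measurable_fun setT (fun z : 'rV[R]_n * 'rV[R]_n => sqdist z.1 z.2).
Proof.
apply: measurable_sum => i; under eq_fun do rewrite !mxE.
apply: measurable_funX; apply: measurable_funB.
- exact: measurableT_comp (measurable_coord i) measurable_fst.
- exact: measurableT_comp (measurable_coord i) measurable_snd.
Qed.

Lemma sqdist_continuous n (x : 'rV[R]_n) : continuous (sqdist x).
Proof.
apply: continuous_big => [|i _]; first exact: add_continuous.
have xi : continuous (fun z : 'rV[R]_n => x ord0 i - z ord0 i).
  move=> y; apply: continuousB; first exact: cst_continuous.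
  exact: coord_continuous.
rewrite (_ : (fun z => (x - z) ord0 i ^+ 2) =
    (fun z => x ord0 i - z ord0 i) \* (fun z => x ord0 i - z ord0 i)).
  by move=> y; exact: cvgM (xi y) (xi y).
by apply/funext => z; rewrite !mxE expr2.
Qed.

Lemma open_eball n (x : 'rV[R]_n) (r : R) : 0 < r -> open (eball x r).
Proof.
move=> r0; rewrite (_ : eball x r = sqdist x @^-1` [set t | t < r ^+ 2]).
  by apply: open_comp; [move=> y _; exact: sqdist_continuous|exact: open_lt].
by apply/seteqP; split => y; rewrite eballE.
Qed.

(** The right side is a closed set containing the ball. It exceeds the ball by a sphere, null by
    [sphere_null]. *)
Lemma closure_eball n (x : 'rV[R]_n) (r : R) : 0 < r ->
  closure (eball x r) `<=` [set y | sqdist x y <= r ^+ 2].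
Proof.
move=> r0.
have cl : closed [set y | sqdist x y <= r ^+ 2].
  apply: (@preimage_closed _ _ (sqdist x) [set t | t <= r ^+ 2]).
    by move=> y _; exact: sqdist_continuous.
  exact: closed_le.
rewrite [X in _ `<=` X](closure_id _).1//; apply: closure_subset.
by move=> y; rewrite eballE//; exact: ltW.
Qed.

Lemma sqdist_cons n (x : 'rV[R]_n.+1) t y :
  sqdist x (rV_cons (t, y)) = (x ord0 ord0 - t) ^+ 2 + sqdist (rV_uncons x).2 y.
Proof.
have subE (z : 'rV[R]_n.+1) i : (x - z) ord0 i = x ord0 i - z ord0 i.
  by rewrite !mxE.
rewrite /sqdist big_ord_recl subE rV_cons0; congr (_ + _).
apply: eq_bigr => i _; rewrite subE rV_consS !mxE; congr ((x _ _ - _) ^+ 2).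
exact/val_inj.
Qed.

Lemma measurable_sphere n (x : 'rV[R]_n) (c : R) :
  measurable [set y | sqdist x y = c].
Proof.
rewrite -[X in measurable X]setTI.
have mx := measurableT_comp (@measurable_sqdist n) (measurable_pair1 x).
exact: (mx measurableT [set c] (measurable_set1 c)).
Qed.

(** Induction on the dimension, slicing along the first coordinate [t]: a slice is a smaller sphere,
    hence null, or empty, except for the two values of [t] where it degenerates to a point.
    Positivity of [c] matters in dimension 0, where a point has mass one. *)
Lemma sphere_null n (x : 'rV[R]_n) (c : R) : 0 < c ->
  lebesgue_rV n [set y | sqdist x y = c] = 0%E.
Proof.
elim: n x c => [|n IH] x c c0.
  by rewrite /= diracE memNset//= /sqdist big_ord0 => /eqP; rewrite lt_eqF.
set S := [set y | _].
have mS : measurable S by exact: measurable_sphere.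
change ((@lebesgue_measure R \x lebesgue_rV n)%E ((@rV_cons R n) @^-1` S) = 0)%E.
have mS' : measurable (@rV_cons R n @^-1` S).
  by rewrite -[X in measurable X]setTI; exact: measurable_rV_cons.
apply/product_measure_null => //.
have sec t : xsection (@rV_cons R n @^-1` S) t =
    [set y | sqdist (rV_uncons x).2 y = c - (x ord0 ord0 - t) ^+ 2].
  apply/seteqP; split => y; rewrite /xsection/= inE /S/= sqdist_cons.
    by move=> <-; rewrite addrC addKr.
  by move=> ->; rewrite addrC subrK.
exists ([set x ord0 ord0 - Num.sqrt c] `|` [set x ord0 ord0 + Num.sqrt c]); split.
- exact: measurableU.
- by apply: countable_lebesgue_measure0; apply: finite_set_countable.
move=> t /= ; rewrite sec; apply: contra_notP => /not_orP[t1 t2].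
have [ct|ct|ct] := ltgtP 0 (c - (x ord0 ord0 - t) ^+ 2).
- exact: IH.
- rewrite (_ : mkset _ = set0) ?measure0//; apply/seteqP; split => // y /= yE.
  by move: ct; rewrite -yE ltNge sumr_ge0// => i _; rewrite sqr_ge0.
- have : (x ord0 ord0 - t) ^+ 2 = Num.sqrt c ^+ 2.
    by rewrite sqr_sqrtr ?ltW//; apply/eqP; rewrite eq_sym -subr_eq0 -ct.
  move/eqP; rewrite eqf_sqr => /orP[] /eqP E; exfalso; [apply: t1|apply: t2]; lra.
Qed.

End euclidean_balls.

(** * Measure of open and bounded sets, and the essential support *)

Section lebesgue_open_sets.
Context {R : realType}.

Lemma measurable_box n (A : 'I_n -> set R) : (forall i, measurable (A i)) ->
  measurable [set x : 'rV[R]_n | forall i, A i (x ord0 i)].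
Proof.
move=> mA; rewrite (_ : mkset _ = \bigcap_(i in [set: 'I_n])
    ((fun x : 'rV[R]_n => x ord0 i) @^-1` A i)); last first.
  by apply/seteqP; split => x /= Ax i; [move=> _; exact: Ax|exact: Ax].
apply: fin_bigcap_measurable; first exact: finite_finset.
by move=> i _; rewrite -[X in measurable X]setTI; exact: measurable_coord.
Qed.

Lemma lebesgue_cube n (x : 'rV[R]_n) (r : R) : 0 < r ->
  (0 < lebesgue_rV n [set y | forall i, ball (x ord0 i) r (y ord0 i)] < +oo)%E.
Proof.
move=> r0; rewrite (lebesgue_rV_box (A := fun i => ball (x ord0 i) r)); last first.
  by move=> i; exact: measurable_ball.
apply: (big_ind (fun z : \bar R => 0 < z < +oo)%E).
- by rewrite lte01 ltry.
- move=> a b /andP[a0 aoo] /andP[b0 boo]; rewrite mule_gt0//=.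
  by rewrite lte_mul_pinfty// ?ltW// ge0_fin_numE// ltW.
- by move=> i _; rewrite lebesgue_measure_ball ?(ltW r0)// lte_fin pmulrn_lgt0// r0 ltry.
Qed.

Lemma open_lebesgue_gt0 n (U : set 'rV[R]_n) : open U -> U !=set0 ->
  (0 < lebesgue_rV n U)%E.
Proof.
move=> oU [x Ux]; have /nbhs_ballP[e /= e0 eU] : nbhs x U by exact: open_nbhs_nbhs.
have /andP[c0 _] := lebesgue_cube x e0; apply: lt_le_trans c0 _.
apply: le_measure; rewrite ?inE.
- by apply: (measurable_box (A := fun i => ball (x ord0 i) e)) => i; exact: measurable_ball.
- exact: open_measurable_rV.
- by move=> y yx; apply: eU; split => // i j; rewrite (ord1 i); exact: yx.
Qed.

Lemma bounded_lebesgue_lty n (A : set 'rV[R]_n) : measurable A ->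
  bounded_set A -> (lebesgue_rV n A < +oo)%E.
Proof.
move=> mA [M [_ /(_ (`|M| + 1))]].
have M1 : 0 < `|M| + 1 by rewrite ltr_wpDl.
rewrite (le_lt_trans (ler_norm M)) ?ltrDl// => /(_ isT) AM.
(* The norm bound [|M| + 1] is not strict while the cube is open, hence one more unit. *)
have M2 : 0 < `|M| + 2 by rewrite ltr_wpDl.
have /andP[_ coo] := lebesgue_cube (0 : 'rV[R]_n) M2; apply: le_lt_trans coo.
apply: le_measure; rewrite ?inE//.
  apply: (measurable_box (A := fun i => ball ((0 : 'rV[R]_n) ord0 i) (`|M| + 2))).
  by move=> i; exact: measurable_ball.
move=> y /AM /= yM i; rewrite /ball/= mxE sub0r normrN.
apply: (@le_lt_trans _ _ (`|M| + 1)); last by rewrite ltrD2l ltr1n.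
apply: le_trans yM; rewrite /Num.norm/= mx_normrE.
exact: (le_bigmax _ (fun ij : 'I_1 * 'I_n => `|y ij.1 ij.2|) (ord0, i)).
Qed.

(** A base of the topology whose index type is countable, so that [pickle] enumerates it. *)
Definition rat_ball n (z : 'rV[rat]_n * nat) : set 'rV[R]_n :=
  ball (map_mx ratr z.1 : 'rV[R]_n) z.2.+1%:R^-1.

Lemma rat_ball_basis n (U : set 'rV[R]_n) (x : 'rV[R]_n) : open U -> U x ->
  exists2 z, rat_ball z x & rat_ball z `<=` U.
Proof.
move=> oU Ux; have /nbhs_ballP[e /= e0 eU] : nbhs x U by exact: open_nbhs_nbhs.
(* A ball of radius below [e / 2] that contains [x] stays within [e] of [x]. *)
have [k ke] : exists k : nat, k.+1%:R^-1 < e / 2.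
  have [k _ /(_ k (leqnn k))] := near_infty_natSinv_lt (PosNum (divr_gt0 e0 (ltr0Sn R 1))).
  by exists k.
have k0 : 0 < k.+1%:R^-1 :> R by rewrite invr_gt0.
have /choice[q qx] i : exists a : rat, ball (ratr a : R) k.+1%:R^-1 (x ord0 i).
  have /rat_in_itvoo[a] : x ord0 i < x ord0 i + k.+1%:R^-1 by rewrite ltrDl.
  rewrite in_itv/= => /andP[a1 a2]; exists a.
  by rewrite /ball/= ger0_norm ?subr_ge0 ?ltW// ltrBlDl.
have xz : rat_ball (\row_i q i, k) x.
  by split => // i j; rewrite (ord1 i) !mxE.
exists (\row_i q i, k) => // y zy; apply: eU.
apply: (@ball_splitr _ _ (map_mx ratr (\row_i q i) : 'rV[R]_n)).
  exact: le_ball (ltW ke) _ xz.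
exact: le_ball (ltW ke) _ zy.
Qed.

(* Lindelof: the union in the definition of the essential support reduces to
   countably many rational balls. *)
Lemma ae_ess_supp n (D : set 'rV[R]_n) (g : 'rV[R]_n -> R) :
  {ae lebesgue_rV n, forall y, D y -> ~ ess_supp D g y -> g y = 0}.
Proof.
pose J := [set z | {ae lebesgue_rV n, forall y, rat_ball z y -> D y -> g y = 0}].
(* Quantifying over codes turns the family into a sequence, so the exceptional sets have a null
   union; codes of no ball, or of a ball outside [J], impose nothing. *)
have : {ae lebesgue_rV n, forall y, forall k : nat, forall z,
    unpickle k = Some z -> J z -> rat_ball z y -> D y -> g y = 0}.
  apply: ae_foralln => k; case: (unpickle k) => [z|]; last exact: aeW.
  have [Jz|nJz] := pselect (J z); last by apply: aeW => y _ [<-].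
  by move: Jz; rewrite {1}/J/=; apply: filterS => y zy _ [<-] _; exact: zy.
apply: filterS => y yJ Dy /contrapT[U [oU aeU] Uy].
have [z zy zU] := rat_ball_basis oU Uy.
apply: (yJ (pickle z) z) => //; first by rewrite pickleK.
by rewrite /J/=; apply: filterS aeU => w wU /zU; exact: wU.
Qed.

End lebesgue_open_sets.

(** * Essential suprema over balls *)

Section essential_bounds.
Context {R : realType} {N : nat}.
Local Notation T := 'rV[R]_N.
Local Notation leb := (@lebesgue_rV R N).

(** The infimum defining the essential supremum is attained. Giving [h] the value [-oo] off [D]
    reduces this to the essential supremum over the whole space, for any set [D]. *)
Lemma ess_sup_on_leP (D : set T) (h : T -> \bar R) y :
  (ess_sup_on D h <= y)%E <-> {ae leb, forall x, D x -> (h x <= y)%E}.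
Proof.
pose h' x := if x \in D then h x else -oo%E.
have h'P z x : (h' x <= z)%E <-> (D x -> h x <= z)%E.
  rewrite /h'; case: ifPn => [|/negP]; rewrite inE => Dx.
    by split => // /(_ Dx).
  by split => // _; exact: leNye.
have -> : ess_sup_on D h = ess_sup leb h'.
  congr ereal_inf; apply/seteqP; split => z /=.
    by apply: filterS => x /h'P.
  by apply: filterS => x /h'P.
by split => [/ess_supP|hy]; [|apply/ess_supP; move: hy];
  apply: filterS => x /h'P.
Qed.

Lemma eq_ess_sup_on (D : set T) (h k : T -> \bar R) :
  {ae leb, forall x, D x -> h x = k x} -> ess_sup_on D h = ess_sup_on D k.
Proof.
move=> hk; apply/eqP; rewrite eq_le; apply/andP; split; apply/ess_sup_on_leP.
  have /ess_sup_on_leP : (ess_sup_on D k <= ess_sup_on D k)%E by [].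
  by apply: filterS2 hk => x hk kx Dx; rewrite hk//; exact: kx.
have /ess_sup_on_leP : (ess_sup_on D h <= ess_sup_on D h)%E by [].
by apply: filterS2 hk => x hk kx Dx; rewrite -hk//; exact: kx.
Qed.

Lemma ess_inf_onN (D : set T) (u : T -> R) :
  ess_inf_on D (EFin \o u) = (- ess_sup_on D (EFin \o (fun x => - u x)%R))%E.
Proof.
rewrite /ess_inf_on /ess_sup_on ereal_infEN oppeK; congr ereal_sup.
apply/seteqP; split => [y uy|_ [y uy <-]] /=.
  exists (- y)%E; last by rewrite oppeK.
  by move: uy => /=; apply: filterS => x uy /uy; rewrite EFinN leeN2.
by move: uy => /=; apply: filterS => x uy /uy; rewrite EFinN leeNl.
Qed.

Variables (Omega : set T) (eps : R).
Hypotheses (oO : open Omega) (eps0 : 0 < eps).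

Definition nbhd x := eball x eps `&` Omega.

Lemma open_nbhd x : open (nbhd x).
Proof. exact/openI/oO/open_eball. Qed.

Lemma nbhd_gt0 x : Omega x -> (0 < leb (nbhd x))%E.
Proof.
move=> Ox; apply: open_lebesgue_gt0; first exact: open_nbhd.
exists x; split => //; rewrite eballE//.
by rewrite /sqdist big1 ?exprn_gt0// => i _; rewrite subrr mxE expr0n.
Qed.

Lemma measurable_nbhd_graph : measurable [set z : T * T | nbhd z.1 z.2].
Proof.
rewrite (_ : mkset _ = (fun z : T * T => sqdist z.1 z.2) @^-1` `]-oo, eps ^+ 2[ `&`
    snd @^-1` Omega); last first.
  by apply/seteqP; split => z; rewrite /nbhd/= in_itv/= eballE.
apply: measurableI; rewrite -[X in measurable X]setTI.
  by apply: measurable_sqdist => //; exact: measurable_itv.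
by apply: measurable_snd => //; exact: open_measurable_rV.
Qed.

Section bounded_function.
Variables (v : T -> R) (M : R).
Hypotheses (mv : measurable_fun setT v) (vM : forall x, `|v x| <= M).

(* Junk when the essential supremum is infinite, which does not happen for [x] in
   [Omega]: see [esupE]. *)
Definition esup x : R := fine (ess_sup_on (nbhd x) (EFin \o v)).

Let excess t : set (T * T) :=
  [set z : T * T | nbhd z.1 z.2] `&` (v \o snd) @^-1` `]t, +oo[.

Let mexcess t : measurable (excess t).
Proof.
apply: measurableI; first exact: measurable_nbhd_graph.
rewrite -[X in measurable X]setTI.
apply: (measurableT_comp mv (@measurable_snd _ _ T T)) => //.
Qed.

(** The lower bound rests on [nbhd_gt0]: over a null set the essential supremum would be [-oo]. *)
Lemma ess_sup_on_nbhd_bound x : Omega x ->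
  (- M%:E <= ess_sup_on (nbhd x) (EFin \o v) <= M%:E)%E.
Proof.
move=> Ox; apply/andP; split; last first.
  apply/ess_sup_on_leP/aeW => y _ /=; rewrite lee_fin.
  exact: le_trans (ler_norm _) (vM y).
rewrite leNgt; apply/negP => ltM.
have /ess_sup_on_leP[A [mA A0 xA]] : (ess_sup_on (nbhd x) (EFin \o v) <=
  ess_sup_on (nbhd x) (EFin \o v))%E by [].
have := nbhd_gt0 Ox; apply/negP; rewrite -leNgt -A0.
apply: le_measure; rewrite ?inE//.
  by apply: open_measurable_rV; exact: open_nbhd.
move=> y xy; apply: xA => /= /(_ xy); apply/negP; rewrite -ltNge.
apply: lt_le_trans ltM _; rewrite lee_fin lerNl; apply: le_trans (vM y).
by rewrite -normrN ler_norm.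
Qed.

Lemma esupE x : Omega x -> ess_sup_on (nbhd x) (EFin \o v) = (esup x)%:E.
Proof.
move=> /ess_sup_on_nbhd_bound/andP[geM leM]; rewrite /esup fineK//.
by rewrite fin_numElt (lt_le_trans _ geM) ?ltNyr// (le_lt_trans leM) ?ltry.
Qed.

Lemma esup_bound x : Omega x -> `|esup x| <= M.
Proof.
move=> Ox; have := ess_sup_on_nbhd_bound Ox.
by rewrite esupE// !lee_fin -ler_norml.
Qed.

Lemma esup_ub x : Omega x -> {ae leb, forall y, nbhd x y -> v y <= esup x}.
Proof.
move=> Ox; have : (ess_sup_on (nbhd x) (EFin \o v) <= (esup x)%:E)%E.
  by rewrite esupE.
by move/ess_sup_on_leP; apply: filterS => y + xy => /(_ xy); rewrite lee_fin.
Qed.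

(** This expresses the essential supremum through measures of sections, which depend measurably on
    [x]. It yields both the measurability of [esup] and the positive normalising constant of the
    near-optimal kernels. *)
Lemma esup_gtP x t : Omega x ->
  (t < esup x) = (0 < leb (xsection (excess t) x))%E.
Proof.
move=> Ox; apply/idP/idP; apply: contraTT; rewrite -!leNgt => h.
  rewrite -lee_fin -esupE//; apply/ess_sup_on_leP.
  exists (xsection (excess t) x); split; first exact: measurable_xsection.
    by apply/eqP; rewrite eq_le h measure_ge0.
  move=> y /not_implyP[xy /negP]; rewrite lee_fin -ltNge => ty.
  by rewrite /xsection/= inE; split => //=; rewrite in_itv/= ty.
rewrite measure_le0; apply/eqP/measure_negligible; first exact: measurable_xsection.
apply: negligibleS (esup_ub Ox) => y; rewrite /xsection/= inE => -[/= xy].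
rewrite in_itv/= andbT => ty /(_ xy); apply/negP; rewrite -ltNge.
exact: le_lt_trans h ty.
Qed.

Lemma measurable_esup : measurable_fun Omega esup.
Proof.
apply: (measurability _ (RGenOInfty.measurableE R)) => _ [_ [t ->] <-].
rewrite (_ : _ `&` _ = Omega `&` (leb \o xsection (excess t)) @^-1` `]0%E, +oo[).
  apply: (measurable_funTS (measurable_fun_xsection leb (mexcess t))) => //.
    exact: open_measurable_rV.
  exact: emeasurable_itv.
apply/seteqP; split => x [Ox] /=; rewrite !in_itv/= !andbT => h; split => //.
  by rewrite -esup_gtP.
by rewrite esup_gtP.
Qed.

End bounded_function.
End essential_bounds.

(** * Kernels *)

Section kernels.
Context {R : realType} {N : nat}.
Local Notation T := 'rV[R]_N.
Local Notation leb := (@lebesgue_rV R N).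
Variables (Omega : set T) (eps : R).
Hypotheses (oO : open Omega) (bO : bounded_set Omega) (eps0 : 0 < eps).

Let mO : measurable Omega. Proof. exact: open_measurable_rV. Qed.
Let mOO : measurable (Omega `*` Omega). Proof. exact: measurableX. Qed.

(** Representatives of admissible kernels. Sign and vanishing hold everywhere, but normalisation
    only almost everywhere, since removing negative values may spoil it for a null set of [x]. *)
Definition kernel_on (P : T * T -> R) : Prop :=
  [/\ measurable_fun setT P, forall z, 0 <= P z,
    forall z, ~ (Omega `*` Omega) z -> P z = 0 &
    {ae leb, forall x, Omega x -> (\int[leb]_y (P (x, y))%:E = 1)%E}].

Section kernel_integral.
Variables (P : T * T -> R) (c : T -> R).
Hypotheses (kP : kernel_on P) (ic : leb.-integrable setT (EFin \o c)).
Hypothesis c0 : forall x, ~ Omega x -> c x = 0.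

Let mc : measurable_fun setT c.
Proof. by apply/measurable_EFinP; exact: measurable_int ic. Qed.

Let mcP : measurable_fun setT (fun z => (c z.1 * P z)%:E).
Proof.
have [mP _ _ _] := kP; apply/measurable_EFinP/measurable_funM => //.
exact: measurableT_comp mc measurable_fst.
Qed.

Let kernel_section (k : R) x : Omega x ->
  (\int[leb]_y (P (x, y))%:E = 1)%E -> (\int[leb]_y (k * P (x, y))%:E = k%:E)%E.
Proof.
have [mP P0 _ _] := kP => Ox P1; under eq_integral do rewrite EFinM.
have mPx : measurable_fun setT (fun y => (P (x, y))%:E).
  by apply/measurable_EFinP; exact: measurableT_comp.
rewrite integralZl ?P1 ?mule1//; apply/integrableP; split => //.
under eq_integral do rewrite gee0_abs ?lee_fin//.
by rewrite P1 ltry.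
Qed.

(** By Tonelli's theorem: the inner integral of the absolute value is [|c x|], because [P (x, _)]
    has mass one. *)
Lemma integrable_kernel :
  (leb \x leb)%E.-integrable setT (fun z => (c z.1 * P z)%:E).
Proof.
have [mP P0 _ P1] := kP; apply/(integrable12ltyP _ _ mcP).
have /integrableP[_] := ic; apply: le_lt_trans.
apply: ae_ge0_le_integral => //.
- by move=> x _; apply: integral_ge0.
- apply: (@measurable_fun_integral_snd _ _ _ _ _ leb (fun z => `|(c z.1 * P z)%:E|)%E).
  exact: measurableT_comp.
- by apply: measurableT_comp => //; exact: measurable_int ic.
apply: filterS P1 => x P1 _ /=; have [Ox|nOx] := pselect (Omega x); last first.
  by rewrite c0//; under eq_integral do rewrite mul0r normr0; rewrite integral0 normr0.
rewrite -(kernel_section `|c x| Ox (P1 Ox)) le_eqVlt; apply/orP; left; apply/eqP.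
by apply: eq_integral => y _; rewrite normrM (ger0_norm (P0 _)).
Qed.

(** Mass one in the second variable lets an integral over [x] be rewritten as a double integral
    against [P], ready for pointwise comparison with [flux]. *)
Lemma integral_kernel :
  (\int[leb \x leb]_z (c z.1 * P z)%:E = \int[leb]_x (c x)%:E)%E.
Proof.
have [_ _ _ P1] := kP; rewrite -integral12_prod_meas1; last exact: integrable_kernel.
apply: ae_eq_integral => //.
- exact: (@measurable_fun_integral_snd _ _ _ _ _ leb _ mcP).
- exact/measurable_EFinP.
apply: filterS P1 => x P1 _; have [Ox|nOx] := pselect (Omega x).
  by rewrite -(kernel_section (c x) Ox (P1 Ox)).
by rewrite c0// /fubini_F; under eq_integral do rewrite /= c0// mul0r; rewrite integral0.
Qed.

End kernel_integral.

(* The sections of [K] have full measure in the balls, so the representative of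
   [Psi] may be set to zero off [K]; later [K] encodes an essential bound. *)
Lemma admissible_kernel (Psi : T * T -> R) (K : set (T * T)) :
  admissible Omega eps Psi -> measurable K ->
  (forall x, Omega x -> {ae leb, forall y, nbhd Omega eps x y -> K (x, y)}) ->
  exists P, [/\ kernel_on P,
    {ae (leb \x leb)%E, forall z, (Omega `*` Omega) z -> Psi z = P z} &
    forall z, P z != 0 -> K z].
Proof.
move=> [_ Psi0 [Phi [mPhi PhiE Phi1]]] mK nK.
have mPhi' := (measurable_restrictT Phi mOO).1 mPhi.
pose W := (Omega `*` Omega) `&` K.
have mW : measurable W by exact: measurableI.
(* The maximum forces the sign and the restriction forces the support, now at every point. *)
pose P := (fun z => Num.max (Phi z) 0) \_ W.
have mP : measurable_fun setT P.
  apply/(measurable_restrictT _ mW)/measurable_maxr => //.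
  by apply: measurable_funS mPhi => // z [].
have P0 z : 0 <= P z.
  by rewrite /P patchE; case: ifPn => // _; rewrite le_max lexx orbT.
have POO z : ~ (Omega `*` Omega) z -> P z = 0.
  by move=> nz; rewrite /P patchE memNset// => -[].
have PhiP : {ae leb, forall x, Omega x ->
    {ae leb, forall y, Omega y -> Phi (x, y) = P (x, y)}}.
  have : {ae (leb \x leb)%E, forall z, (Omega `*` Omega) z -> 0 <= Phi z}.
    by apply: filterS2 Psi0 PhiE => z z0 zE zO; rewrite zE//; exact: z0.
  move/ae_xsection; apply: filterS => x Phi0 Ox.
  have [_ supp] := Phi1 x Ox.
  (* The support condition speaks of the closed ball and [nK] of the open one; they differ by a null
     sphere. *)
  have sph : {ae leb, forall y, sqdist x y <> eps ^+ 2}.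
    exists [set y | sqdist x y = eps ^+ 2]; split.
    - exact: measurable_sphere.
    - by apply: sphere_null; rewrite exprn_gt0.
    - by move=> y /= /contrapT.
  have ess := ae_ess_supp Omega (fun y => Phi (x, y)).
  apply: filterS (filterI (filterI sph ess) (filterI (nK x Ox) Phi0)) => y.
  move=> [[sphy essy] [Ky {}Phi0]] Oy.
  (* Off the essential support both functions vanish; on it, [y] lies in the open ball, hence in the
     section of [K]. *)
  have [|ns] := pselect (ess_supp Omega (fun y => Phi (x, y)) y); last first.
    by rewrite essy// /P patchE; case: ifPn => //; rewrite essy// maxxx.
  move/supp => [/(closure_eball eps0)/= le_eps _].
  rewrite /P patchE mem_set; first by rewrite max_l//; exact: Phi0.
  split => //; apply: Ky; split => //; rewrite eballE// lt_neqAle le_eps andbT.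
  exact/eqP.
exists P; split.
- split => //.
  apply: filterS PhiP => x PhiP Ox; have [<- _] := Phi1 x Ox.
  rewrite [RHS]integral_mkcond; apply: ae_eq_integral => //.
  + by apply/measurable_EFinP; exact: measurableT_comp.
  + rewrite (_ : _ \_ _ = fun y => ((Phi \_ (Omega `*` Omega)) (x, y))%:E).
      by apply/measurable_EFinP; exact: measurableT_comp.
    apply/funext => y; rewrite !patchE in_setX/= (mem_set Ox)/=.
    by case: ifPn.
  + apply: filterS (PhiP Ox) => y yE _; rewrite patchE.
    case: ifPn => [|/negP]; rewrite inE => Oy.
      by rewrite yE.
    by rewrite POO// => -[].
(* Equality on almost all sections lifts to the product because both functions are measurable. *)
- have : {ae (leb \x leb)%E, forall z, (Phi \_ (Omega `*` Omega)) z = P z}.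
    apply: ae_product.
      rewrite (_ : (fun z => _) =
          (fun z => (Phi \_ (Omega `*` Omega)) z == P z) @^-1` [set true]).
        by rewrite -[X in measurable X]setTI; exact: (measurable_fun_eqr mPhi' mP).
      by apply/seteqP; split => z /= /eqP.
    apply: filterS PhiP => x xE.
    have [Ox|nOx] := pselect (Omega x); last first.
      by apply: aeW => y /=; rewrite patchE memNset ?POO// => -[].
    apply: filterS (xE Ox) => y yE /=; rewrite patchE; case: ifPn => [|/negP]; rewrite inE.
      by move=> [_ Oy]; exact: yE.
    by move/POO.
  by apply: filterS2 PhiE => z zE PE zO; rewrite -zE// -PE patchE mem_set.
- move=> z; rewrite /P patchE; case: ifPn; last by rewrite eqxx.
  by rewrite inE => -[].
Qed.

End kernels.

(** * One-sided variation *)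

Section one_sided_variation.
Context {R : realType} {N : nat}.
Local Notation T := 'rV[R]_N.
Local Notation leb := (@lebesgue_rV R N).
Variables (Omega : set T) (eps : R).
Hypotheses (oO : open Omega) (bO : bounded_set Omega) (eps0 : 0 < eps).

Let mO : measurable Omega. Proof. exact: open_measurable_rV. Qed.
Let mOO : measurable (Omega `*` Omega). Proof. exact: measurableX. Qed.

Variables (v : T -> R) (M : R).
Hypotheses (mv : measurable_fun setT v) (vM : forall x, `|v x| <= M).

(** [esup] is controlled only on [Omega]; cut to zero elsewhere, it is measurable and bounded by [M]
    everywhere. *)
Let S : T -> R := esup Omega eps v \_ Omega.

Let mS : measurable_fun setT S.
Proof. by apply/(measurable_restrictT _ mO); exact: measurable_esup mv vM. Qed.

Let SE x : Omega x -> S x = esup Omega eps v x.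
Proof. by move=> Ox; rewrite /S patchE mem_set. Qed.

Let SM x : `|S x| <= M.
Proof.
rewrite /S patchE; case: ifPn => [|_]; first by rewrite inE; exact: esup_bound.
by rewrite normr0; exact: le_trans (vM x).
Qed.

(** Positive [k] serves the near-optimal kernels; [k = 0] serves, by complement, the upper bound by
    [esup]. *)
Lemma measurable_below_esup (k : R) :
  measurable [set z : T * T | (S z.1 - k < v z.2)].
Proof.
rewrite (_ : mkset _ = (fun z : T * T => S z.1 - k < v z.2) @^-1` [set true])//.
rewrite -[X in measurable X]setTI; apply: measurable_fun_ltr => //.
  by apply: measurable_funB => //; exact: measurableT_comp mS measurable_fst.
exact: measurableT_comp mv measurable_snd.
Qed.

(** [P (x, _)] is the uniform density on the section of [W] at [x]. This section has positive
    measure because its threshold is below the essential supremum, and finite measure because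
    [Omega] is bounded. *)
Lemma near_optimal_kernel (k : R) : 0 < k -> exists P,
  [/\ admissible Omega eps P, kernel_on Omega P,
    forall z, P z != 0 -> nbhd Omega eps z.1 z.2 &
    forall z, P z != 0 -> esup Omega eps v z.1 - k < v z.2].
Proof.
move=> k0; pose W : set (T * T) := (Omega `*` setT) `&`
  ([set z | nbhd Omega eps z.1 z.2] `&` [set z | S z.1 - k < v z.2]).
have mW : measurable W.
  apply: measurableI; first exact: measurableX.
  apply: measurableI; first exact: measurable_nbhd_graph.
  exact: measurable_below_esup.
have WO z : W z -> (Omega `*` Omega) z by move=> [[? _] [[]]].
pose d x := leb (xsection W x).
have doo x : (d x < +oo)%E.
  apply: le_lt_trans (bounded_lebesgue_lty mO bO).
  apply: le_measure; rewrite ?inE//; first exact: measurable_xsection.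
  by move=> y; rewrite /xsection/= inE => /WO[].
have d0 x : Omega x -> (0 < d x)%E.
  move=> Ox; have : esup Omega eps v x - k < esup Omega eps v x by rewrite ltrBlDr ltrDl.
  rewrite (esup_gtP oO eps0 mv vM)//; congr (0 < leb _)%E.
  apply/seteqP; split => y; rewrite /xsection/= !inE/= in_itv/= andbT.
    by move=> [xy ky]; split => //; split => //; rewrite /= SE.
  by move=> [_ [xy]]; rewrite /= SE.
have dfin x : d x \is a fin_num by rewrite ge0_fin_numE// measure_ge0.
have md : measurable_fun setT (fine \o d).
  by apply: measurableT_comp => //; exact: measurable_fun_xsection.
(* For [z.1] outside [Omega] the section is empty and the inverse is the inverse of 0; the indicator
   vanishes there. *)
pose P z : R := \1_W z * (fine (d z.1))^-1.
have P0 z : 0 <= P z by rewrite mulr_ge0// invr_ge0 fine_ge0// measure_ge0.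
have mP : measurable_fun setT P.
  apply: measurable_funM; first exact: measurable_indic.
  (* The power with exponent -1 is measurable and equals the inverse on nonnegative reals, zero
     included. *)
  rewrite (_ : (fun z => _) = (fun t => t `^ (-1)) \o ((fine \o d) \o fst)).
    apply: measurableT_comp; first exact: measurable_powR.
    exact: measurableT_comp md measurable_fst.
  by apply/funext => z /=; rewrite powR_inv1// fine_ge0// measure_ge0.
have PW z : P z != 0 -> W z.
  by rewrite /P indicE; have [/set_mem//|_] := boolP (z \in W); rewrite mul0r eqxx.
have P1 x : Omega x -> (\int[leb]_y (P (x, y))%:E = 1)%E.
  move=> Ox; rewrite /P/=; under eq_integral do rewrite EFinM.
  rewrite ge0_integralZr//; last 2 first.
  - by apply/measurable_EFinP; apply: measurableT_comp => //; exact: measurable_indic.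
  - by rewrite lee_fin invr_ge0 fine_ge0// measure_ge0.
  rewrite (_ : \int[leb]_y _ = d x)%E; last first.
    by rewrite -[LHS]/(fubini_F leb (EFin \o \1_W) x) indic_fubini_tonelli_FE.
  by rewrite -{1}(fineK (dfin x)) -EFinM mulfV// gt_eqF// fine_gt0// d0//=.
have POO z : ~ (Omega `*` Omega) z -> P z = 0.
  by move=> nz; apply/eqP/negPn/negP => /PW/WO.
have kP : kernel_on Omega P by split => //; apply: aeW.
exists P; split => //.
- split.
  (* Integrability of [P] is the case of [integrable_kernel] where [c] is the indicator of [Omega],
     a set of finite measure. *)
  + have i1 : leb.-integrable setT (EFin \o \1_Omega).
      apply/integrableP; split; first exact/measurable_EFinP/measurable_indic.
      under eq_integral do rewrite gee0_abs ?lee_fin//.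
      by rewrite integral_indic// setIT; exact: bounded_lebesgue_lty.
    have c0 x : ~ Omega x -> \1_Omega x = 0 :> R by move=> ?; rewrite indicE memNset.
    have := integrable_kernel kP i1 c0 => /(integrableS measurableT mOO (subsetT _)).
    apply: eq_integrable => // z /set_mem[Oz1 Oz2] /=.
    by rewrite indicE mem_set// mul1r.
  + exact: aeW.
  + exists P; split => //.
    * by apply: measurable_funTS.
    * exact: aeW.
    move=> x Ox; split.
      rewrite integral_mkcond -[RHS](P1 x Ox); apply: eq_integral => y _.
      rewrite patchE; case: ifPn => // /negP; rewrite inE => nOy.
      by rewrite POO// => -[].
    move=> y yS; apply: contrapT => ny; apply: yS.
    (* This open set is one of those removed from the essential support, since [P (x, _)] vanishes
       on its part in [Omega]. *)
    exists (~` (closure (eball x eps) `&` closure Omega)) => //; split.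
      by apply: closed_openC; apply: closedI; exact: closed_closure.
    apply: aeW => w nw Ow; apply/eqP/negPn/negP => /PW [_ [[xw _] _]].
    by apply: nw; split; apply: subset_closure.
- by move=> z /PW[_ []].
- by move=> z /PW[[Oz _] [_]] /=; rewrite SE.
Qed.

Variable r : T -> R.
Hypotheses (r0 : forall x, 0 <= r x) (rO : forall x, ~ Omega x -> r x = 0).
Hypothesis ir : leb.-integrable setT (EFin \o r).

Let mr : measurable_fun setT r.
Proof. by apply/measurable_EFinP; exact: measurable_int ir. Qed.

(** Integrand of one half of the total variation: the supremum half for [v], the infimum half once
    [v] is replaced by its opposite. *)
Definition excess_density x : R := (S x - v x) / eps * r x.

Lemma integrable_excess : leb.-integrable setT (EFin \o excess_density).
Proof.
have ib : leb.-integrable setT (fun x => ((M + M) / eps)%:E * (r x)%:E)%E.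
  exact: integrableZl.
apply: le_integrable ib => //.
  apply/measurable_EFinP/measurable_funM => //; apply: measurable_funM => //.
  exact: measurable_funB.
move=> x _; rewrite /= lee_fin /excess_density !normrM (ger0_norm (r0 x)).
apply: ler_wpM2r => //; apply: ler_wpM2r => //.
apply: le_trans (ler_norm _); apply: le_trans (ler_normB _ _) _.
exact: lerD.
Qed.

Lemma excess_off x : ~ Omega x -> excess_density x = 0.
Proof. by move=> nx; rewrite /excess_density rO// mulr0. Qed.

(** Changing [u] on a null set alters no essential supremum, so the integrands differ only on a null
    set of [x]. *)
Lemma one_sidedE (u rho : T -> R) : measurable_fun Omega u ->
  measurable_fun Omega rho ->
  {ae leb, forall x, Omega x -> u x = v x} ->
  {ae leb, forall x, Omega x -> rho x = r x} ->
  (\int[leb]_(x in Omega)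
     ((ess_sup_on (eball x eps `&` Omega) (EFin \o u) - (u x)%:E)
        * eps^-1%:E * (rho x)%:E) = \int[leb]_x (excess_density x)%:E)%E.
Proof.
move=> mu mrho uv rhor.
rewrite [RHS](_ : _ = \int[leb]_(x in Omega) (excess_density x)%:E)%E;
  last first.
  rewrite [RHS]integral_mkcond; apply: eq_integral => x _; rewrite patchE.
  by case: ifPn => // /negP; rewrite inE => /excess_off ->.
have supE x : Omega x -> ess_sup_on (eball x eps `&` Omega) (EFin \o u) = (S x)%:E.
  move=> Ox; rewrite SE// -(esupE oO eps0 vM)//; apply: eq_ess_sup_on.
  by apply: filterS uv => y uv [_ Oy] /=; rewrite uv.
under eq_integral => x /set_mem Ox do rewrite supE// -EFinB -!EFinM.
apply: ae_eq_integral => //.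
- apply/measurable_EFinP/measurable_funM => //; apply: measurable_funM => //.
  by apply: measurable_funB => //; exact: measurable_funTS.
- by apply: measurable_funTS; exact: measurable_int integrable_excess.
by apply: filterS2 uv rhor => x uv rhor Ox; rewrite /excess_density uv// rhor.
Qed.

Variable P : T * T -> R.
Hypothesis kP : kernel_on Omega P.

Let POmega z : P z != 0 -> Omega z.1.
Proof.
have [_ _ POO _] := kP; move=> Pz; apply: contrapT => nz; move/eqP: Pz; apply.
by apply: POO => -[].
Qed.

(** Integrand of the gradient pairing for a single kernel and a single density. *)
Definition flux z : R := (v z.2 - v z.1) / eps * (P z * r z.1).

Lemma integrable_flux : (leb \x leb)%E.-integrable setT (EFin \o flux).
Proof.
have [mP P0 _ _] := kP.
have ib : leb.-integrable setT (fun x => ((M + M) / eps)%:E * (r x)%:E)%E.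
  exact: integrableZl.
have := integrable_kernel kP ib; rewrite /= => ib'.
apply: (le_integrable _ _ _ (ib' _)) => //.
- apply/measurable_EFinP/measurable_funM; last first.
    by apply: measurable_funM => //; exact: measurableT_comp mr measurable_fst.
  apply: measurable_funM => //; apply: measurable_funB.
    exact: measurableT_comp mv measurable_snd.
  exact: measurableT_comp mv measurable_fst.
- move=> z _; rewrite /= lee_fin /flux !normrM.
  rewrite (ger0_norm (r0 _)) [_ * r _]mulrC mulrA.
  apply: ler_wpM2r => //; apply: ler_wpM2r => //; apply: ler_wpM2r => //.
  apply: le_trans (ler_norm _); apply: le_trans (ler_normB _ _) _.
  exact: lerD.
- by move=> x /rO ->; rewrite mulr0.
Qed.

(** By [integral_kernel] the right side is the double integral of [excess_density] against [P]; the
    integrands then compare pointwise, both being zero where [P] is. *)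
Lemma flux_le : (forall z, P z != 0 -> v z.2 <= esup Omega eps v z.1) ->
  (\int[leb \x leb]_z (flux z)%:E <= \int[leb]_x (excess_density x)%:E)%E.
Proof.
have [mP P0 _ _] := kP => PS.
rewrite -(integral_kernel kP integrable_excess excess_off).
apply: le_integral => //.
- exact: integrable_flux.
- exact: integrable_kernel kP integrable_excess excess_off.
move=> z _; rewrite lee_fin /flux /excess_density.
have [->|Pz] := eqVneq (P z) 0; first by rewrite !mulr0 mul0r mulr0.
rewrite -[leRHS]mulrA [r _ * _]mulrC; apply: ler_wpM2r; first by rewrite mulr_ge0.
by apply: ler_wpM2r; [rewrite invr_ge0 ltW|rewrite lerB// SE ?PS//; exact: POmega].
Qed.

(** The argument of [flux_le] in reverse, for the excess density lowered by [k / eps * r x]. *)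
Lemma flux_ge (k : R) : (forall z, P z != 0 -> esup Omega eps v z.1 - k < v z.2) ->
  (\int[leb]_x (excess_density x)%:E - (k / eps)%:E * \int[leb]_x (r x)%:E <=
   \int[leb \x leb]_z (flux z)%:E)%E.
Proof.
have [mP P0 _ _] := kP => PS.
have ik : leb.-integrable setT (EFin \o (fun x => excess_density x - k / eps * r x)).
  apply: (@integrableB _ _ _ _ _ _ (EFin \o excess_density)
    (fun x => (k / eps)%:E * (r x)%:E)%E) => //.
    exact: integrable_excess.
  exact: integrableZl.
have koff x : ~ Omega x -> excess_density x - k / eps * r x = 0.
  by move=> nx; rewrite excess_off// rO// mulr0 subr0.
rewrite -integralZl// -integralB//; last 2 first.
- exact: integrable_excess.
- exact: integrableZl.
rewrite -[X in (X <= _)%E](integral_kernel kP ik koff).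
apply: le_integral => //.
- exact: integrable_kernel kP ik koff.
- exact: integrable_flux.
move=> z _; rewrite lee_fin /flux /excess_density.
have [->|Pz] := eqVneq (P z) 0; first by rewrite !mulr0 mul0r mulr0.
rewrite (_ : _ * P z = (S z.1 - k - v z.1) / eps * (P z * r z.1)); last first.
  by rewrite -!mulrBl addrAC [P z * _]mulrC mulrA.
apply: ler_wpM2r; first by rewrite mulr_ge0.
by apply: ler_wpM2r; [rewrite invr_ge0 ltW|rewrite lerB// ltW// SE ?PS//; exact: POmega].
Qed.

End one_sided_variation.

(** * Gradient and divergence pairings *)

Section nonlocal_pairings.
Context {R : realType} {N : nat}.
Local Notation T := 'rV[R]_N.
Local Notation leb := (@lebesgue_rV R N).
Variables (Omega : set T) (eps : R).
Hypotheses (oO : open Omega) (eps0 : 0 < eps).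

Let mO : measurable Omega. Proof. exact: open_measurable_rV. Qed.
Let mOO : measurable (Omega `*` Omega). Proof. exact: measurableX. Qed.

Variables (u v : T -> R) (M : R) (f F : T * T -> R).
Hypotheses (mu : measurable_fun Omega u) (mv : measurable_fun setT v).
Hypotheses (vM : forall x, `|v x| <= M).
Hypothesis uv : {ae leb, forall x, Omega x -> u x = v x}.
Hypotheses (mf : measurable_fun (Omega `*` Omega) f).
Hypothesis iF : (leb \x leb)%E.-integrable setT (EFin \o F).
Hypothesis fF : {ae (leb \x leb)%E, forall z, (Omega `*` Omega) z -> f z = F z}.
Hypothesis Fnbhd : forall z, F z != 0 -> Omega z.1 /\ nbhd Omega eps z.1 z.2.

Let mv1 : measurable_fun setT (fun z : T * T => v z.1).
Proof. exact: measurableT_comp mv measurable_fst. Qed.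

Let mv2 : measurable_fun setT (fun z : T * T => v z.2).
Proof. exact: measurableT_comp mv measurable_snd. Qed.

Let i1 : (leb \x leb)%E.-integrable setT (fun z => (v z.1 / eps * F z)%:E).
Proof.
apply: (@integrable_bounded_mul _ _ _ _ _ _ (M / eps)) iF.
  exact: measurable_funM.
move=> z; rewrite normrM (@ger0_norm _ eps^-1) ?invr_ge0 ?(ltW eps0)//.
by rewrite ler_wpM2r// invr_ge0 ltW.
Qed.

Let i2 : (leb \x leb)%E.-integrable setT (fun z => (v z.2 / eps * F z)%:E).
Proof.
apply: (@integrable_bounded_mul _ _ _ _ _ _ (M / eps)) iF.
  exact: measurable_funM.
move=> z; rewrite normrM (@ger0_norm _ eps^-1) ?invr_ge0 ?(ltW eps0)//.
by rewrite ler_wpM2r// invr_ge0 ltW.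
Qed.

(** Here [f] is the bracket as given, controlled on [Omega] only, and [F] its integrable
    representative, just as [v] represents [u]. *)
Lemma grad_pairingE :
  (\int[leb]_(x in Omega) \int[leb]_(y in Omega)
     ((grad_eps eps u (x, y) * f (x, y))%:E) =
   \int[leb \x leb]_z ((v z.2 - v z.1) / eps * F z)%:E)%E.
Proof.
apply: (@integral_iterated_ae _ _ _ _ _ leb leb Omega Omega
  (fun z => (grad_eps eps u z * f z)%:E)) => //.
- apply/measurable_EFinP/measurable_funM => //; apply: measurable_funM => //.
  apply: measurable_funB.
    by apply: (measurable_comp mO _ mu) => [_ [z [_ ?] <-]|]//; exact: measurable_funTS.
  by apply: (measurable_comp mO _ mu) => [_ [z [? _] <-]|]//; exact: measurable_funTS.
- rewrite (_ : (fun z => _) = (fun z => (v z.2 / eps * F z)%:E) \-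
      (fun z => (v z.1 / eps * F z)%:E))%E.
    exact: integrableB.
  by apply/funext => z; rewrite -EFinB -mulrBl -mulrBl.
- move=> z nz; rewrite (_ : F z = 0) ?mulr0//; apply/eqP/negPn/negP.
  by move=> /Fnbhd[Oz [_ Oz2]]; apply: nz.
have u1 := @ae_fst _ _ _ _ _ leb leb _ uv.
have u2 := @ae_snd _ _ _ _ _ leb leb _ uv.
apply: filterS3 u1 u2 fF => z u1 u2 fz zO; have [z1 z2] := zO.
by rewrite /grad_eps u1// u2// fz.
Qed.

(** The pairs over which [div_eps] integrates, the centre coming first. The set is symmetric, so off
    it [F] vanishes at a pair and at the exchanged pair. *)
Let W : set (T * T) := (Omega `*` setT) `&` [set z | nbhd Omega eps z.1 z.2].

Let mW : measurable W.
Proof. by apply: measurableI; [exact: measurableX|exact: measurable_nbhd_graph]. Qed.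

Let WOO z : W z -> (Omega `*` Omega) z /\ (Omega `*` Omega) (z.2, z.1).
Proof. by move=> [[? _] [_ ?]]. Qed.

Let WF z : ~ W z -> F z = 0 /\ F (z.2, z.1) = 0.
Proof.
move=> nW; split; apply/eqP/negPn/negP => /Fnbhd[/= z1 [z12 z2]]; apply: nW => //.
split => //; split => //=; move: z12; rewrite !eballE//.
by rewrite sqdistC.
Qed.

Let h := (fun z => ((f z - f (z.2, z.1)) / eps)%:E) \_ W.
Let h' z := ((F z - F (z.2, z.1)) / eps)%:E.

Let mh : measurable_fun setT h.
Proof.
apply/(measurable_restrictT _ mW)/measurable_EFinP/measurable_funM => //.
apply: measurable_funB; first by apply: measurable_funS mf => // z /WOO[].
apply: (measurable_comp mOO _ mf) => [_ [z /WOO[_ ?] <-]|]//.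
apply: measurable_funTS; exact: (@measurable_swap _ _ T T).
Qed.

Let ih' : (leb \x leb)%E.-integrable setT h'.
Proof.
rewrite (_ : h' = (fun z => (eps^-1)%:E * ((F z)%:E - (F (z.2, z.1))%:E)))%E.
  apply: integrableZl => //; apply: integrableB => //.
  exact: (integrable_swap iF).
by apply/funext => z; rewrite /h' mulrC EFinM EFinB.
Qed.

Let hh' : {ae (leb \x leb)%E, forall z, h z = h' z}.
Proof.
apply: filterS2 fF (ae_swap fF) => z fz fs; rewrite /h /h' patchE.
case: ifPn => [/set_mem/WOO[? ?]|/negP]; first by rewrite fz// fs.
by rewrite inE => /WF[-> ->]; rewrite subrr mul0r.
Qed.

(** The integral of [v z.1] against the antisymmetric quotient [h'] splits into two integrals;
    exchanging the variables in the second gives minus the gradient form. *)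
Lemma div_pairingE :
  ((- \int[leb]_(y in Omega) ((u y)%:E * div_eps Omega eps f y)) =
   \int[leb \x leb]_z ((v z.2 - v z.1) / eps * F z)%:E)%E.
Proof.
have mh' : measurable_fun setT h' by exact: measurable_int ih'.
have divE y : Omega y -> div_eps Omega eps f y = (\int[leb]_x h (y, x))%E.
  move=> Oy; rewrite /div_eps integral_mkcond; apply: eq_integral => x _.
  rewrite /h !patchE; congr (if _ then _ else _).
  by apply/idP/idP; rewrite !inE; [move=> ?; split|move=> -[]].
pose g z := ((v z.1)%:E * h' z)%E.
have mg : measurable_fun setT g by apply: emeasurable_funM => //; exact/measurable_EFinP.
have i1s := integrable_swap i2.
have gE z : g z = ((v z.1 / eps * F z)%:E - (v z.1 / eps * F (z.2, z.1))%:E)%E.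
  rewrite /g /h' -EFinM -EFinB; congr EFin.
  by rewrite -mulrBr mulrAC mulrA mulrAC -mulrA mulrCA mulrA.
have ig : (leb \x leb)%E.-integrable setT g.
  by rewrite (funext gE); exact: integrableB.
have -> : (\int[leb]_(y in Omega) ((u y)%:E * div_eps Omega eps f y) =
    \int[leb \x leb]_z g z)%E.
  under eq_integral => y /set_mem Oy do rewrite divE//.
  rewrite -integral12_prod_meas1// integral_mkcond; apply: ae_eq_integral => //.
  - apply/(measurable_restrictT _ mO)/emeasurable_funM; first exact/measurable_EFinP.
    exact: measurable_funTS (measurable_fun_integral_snd leb mh).
  - exact: measurable_fun_integral_snd.
  apply: filterS3 uv (ae_eq_integral_snd mh mh' hh') (ae_integrable1 ih') => y uy hy iy _.
  rewrite patchE /fubini_F /g/= integralZl//.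
  case: ifPn => [/set_mem Oy|/negP]; first by rewrite uy// hy.
  rewrite inE => nOy; rewrite integral0_eq ?mule0// => x _; rewrite /h'.
  by have [|-> /= ->] := @WF (y, x); [move=> -[[]]|rewrite subrr mul0r].
under eq_integral do rewrite gE.
(* The second term, in [F (z.2, z.1)], becomes the one with [v z.2] and [F z]; finiteness permits
   distributing the sign. *)
rewrite integralB// (integral_swap i2) oppeB; last first.
  by rewrite fin_num_adde_defl// fin_numN integrable_fin_num.
rewrite addeC -integralB//; apply: eq_integral => z _.
by rewrite -EFinB -mulrBl -mulrBl.
Qed.

End nonlocal_pairings.

(** * Representatives and duality *)

Section representatives.
Context {R : realType} {N : nat}.
Local Notation T := 'rV[R]_N.
Local Notation leb := (@lebesgue_rV R N).
Variable Omega : set T.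
Hypothesis mO : measurable Omega.

Lemma Linfty_repr (u : T -> R) : Linfty Omega u -> exists (v : T -> R) (M : R),
  [/\ measurable_fun setT v, forall x, `|v x| <= M &
      {ae leb, forall x, Omega x -> u x = v x}].
Proof.
move=> [mu ulty].
have [M uM] : exists M : R, (ess_sup_on Omega (fun x => `|u x|%:E) <= M%:E)%E.
  by move: ulty; case: ess_sup_on => [M| |]// _; [exists M|exists 0; rewrite leNye].
(* The absolute value of [M] keeps the bound valid where the cut function is zero. *)
pose D := Omega `&` [set x | `|u x| <= `|M|].
have mD : measurable D.
  rewrite /D (_ : [set x | _] = (fun x => `|u x|) @^-1` `]-oo, `|M|]).
    have mn : measurable_fun Omega (fun x => `|u x|) by exact: measurableT_comp.
    by apply: mn => //; exact: measurable_itv.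
  by apply/seteqP; split => x; rewrite /= in_itv.
exists (u \_ D), `|M|; split.
- by apply/(measurable_restrictT _ mD); apply: measurable_funS mu => // x [].
- by move=> x; rewrite patchE; case: ifPn => [/set_mem[]|_]//; rewrite normr0.
move/ess_sup_on_leP : uM; apply: filterS => x uM Ox; rewrite patchE mem_set//.
split => //=; move: (uM Ox); rewrite lee_fin => /le_trans; apply; exact: ler_norm.
Qed.

(** On the set where [rho] is negative its integral is a value of [nu], hence nonnegative; so this
    set is null and the positive part represents [rho]. *)
Lemma density_repr (nu : set T -> \bar R) (rho : T -> R) :
  (forall A, 0 <= nu A)%E -> is_density Omega nu rho -> exists r : T -> R,
  [/\ forall x, 0 <= r x, forall x, ~ Omega x -> r x = 0,
      leb.-integrable setT (EFin \o r) &
      {ae leb, forall x, Omega x -> rho x = r x}].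
Proof.
move=> nu0 [irho nuE].
have mrho : measurable_fun Omega rho by apply/measurable_EFinP; exact: measurable_int irho.
pose A := Omega `&` rho @^-1` `]-oo, 0[.
have mA : measurable A by apply: mrho => //; exact: measurable_itv.
have AO : A `<=` Omega by move=> x [].
have An x : A x -> rho x < 0 by move=> [_ /=]; rewrite in_itv.
have mrhoA : measurable_fun A (EFin \o rho).
  by apply/measurable_EFinP; exact: measurable_funS mrho.
have A0 : leb.-negligible A.
  have : (\int[leb]_(x in A) `|(rho x)%:E| = 0)%E.
    apply/eqP; rewrite eq_le; apply/andP; split; last exact: integral_ge0.
    rewrite -oppe_ge0 -integral_ge0N// (eq_integral (fun x => (rho x)%:E)).
      by rewrite -nuE.
    by move=> x /set_mem/An x0; rewrite abse_EFin ltr0_norm// -EFinN opprK.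
  move/(ae_eq_integral_abs _ mA mrhoA); apply: negligibleS => x Ax /= /(_ Ax).
  by move=> [x0]; have := An x Ax; rewrite x0 ltxx.
exists ((fun x => Num.max (rho x) 0) \_ Omega); split.
- by move=> x; rewrite patchE; case: ifPn => // _; rewrite le_max lexx orbT.
- by move=> x nx; rewrite patchE memNset.
- rewrite (_ : _ \o _ = (fun x => (Num.max (rho x) 0)%:E) \_ Omega); last first.
    by apply/funext => x; rewrite /= !patchE; case: ifPn.
  apply/(integrable_mkcond _ mO); apply: le_integrable irho => //.
    exact/measurable_EFinP/measurable_maxr.
  move=> x _; rewrite /= lee_fin; case: (leP (rho x) 0) => h.
    by rewrite normr0.
  by [].
exists A; split; [by []|exact: measure_negligible|].
move=> x /= /not_implyP[Ox]; rewrite patchE mem_set//.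
case: leP => // x0 /eqP neq0; split => //=.
by rewrite in_itv/= lt_neqAle neq0.
Qed.

End representatives.

(** * Assembly of the two halves into the duality *)

Section duality.
Context {R : realType} {N : nat}.
Local Notation T := 'rV[R]_N.
Local Notation leb := (@lebesgue_rV R N).
Variables (Omega : set T) (eps : R).
Hypotheses (oO : open Omega) (bO : bounded_set Omega) (eps0 : 0 < eps).

Let mO : measurable Omega. Proof. exact: open_measurable_rV. Qed.
Let mOO : measurable (Omega `*` Omega). Proof. exact: measurableX. Qed.

Variables (u v : T -> R) (M : R).
Hypotheses (mu : measurable_fun Omega u) (mv : measurable_fun setT v).
Hypotheses (vM : forall x, `|v x| <= M).
Hypothesis uv : {ae leb, forall x, Omega x -> u x = v x}.
Variables (rho0 rho1 r0 r1 : T -> R).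
Hypotheses (mrho0 : measurable_fun Omega rho0) (mrho1 : measurable_fun Omega rho1).
Hypotheses (r0_ge0 : forall x, 0 <= r0 x) (r1_ge0 : forall x, 0 <= r1 x).
Hypotheses (r0O : forall x, ~ Omega x -> r0 x = 0) (r1O : forall x, ~ Omega x -> r1 x = 0).
Hypotheses (ir0 : leb.-integrable setT (EFin \o r0)).
Hypotheses (ir1 : leb.-integrable setT (EFin \o r1)).
Hypothesis rho0E : {ae leb, forall x, Omega x -> rho0 x = r0 x}.
Hypothesis rho1E : {ae leb, forall x, Omega x -> rho1 x = r1 x}.

Local Notation Nv := (fun x => - v x).

Let mNv : measurable_fun setT Nv.
Proof. exact: measurable_funN. Qed.

Let NvM x : `|- v x| <= M. Proof. by rewrite normrN. Qed.

Local Notation V0 := (\int[leb]_x (excess_density Omega eps v r0 x)%:E)%E.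
Local Notation V1 := (\int[leb]_x (excess_density Omega eps Nv r1 x)%:E)%E.

Lemma TV_epsE : TV_eps Omega eps (rho0, rho1) u = (V0 + V1)%E.
Proof.
have mNu : measurable_fun Omega (fun x => - u x) by exact: measurable_funN.
have Nuv : {ae leb, forall x, Omega x -> - u x = - v x}.
  by apply: filterS uv => x xE Ox; rewrite xE.
rewrite /TV_eps/=; congr (_ + _)%E.
  exact: (one_sidedE oO eps0 mv vM r0_ge0 r0O ir0 mu mrho0 uv rho0E).
rewrite -(one_sidedE oO eps0 mNv NvM r1_ge0 r1O ir1 mNu mrho1 Nuv rho1E).
apply: eq_integral => x _; rewrite ess_inf_onN oppeK EFinN oppeK addeC.
by [].
Qed.

Definition grad_pairing (Psi : (T * T -> R) * (T * T -> R)) :=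
  (\int[leb]_(x in Omega) \int[leb]_(y in Omega)
     (grad_eps eps u (x, y) * bracket Psi (rho0, rho1) (x, y))%:E)%E.

Definition div_pairing (Psi : (T * T -> R) * (T * T -> R)) :=
  (- \int[leb]_(y in Omega)
     ((u y)%:E * div_eps Omega eps (bracket Psi (rho0, rho1)) y))%E.

Section pairing_values.
Variables Psi P : (T * T -> R) * (T * T -> R).
Hypothesis adm : (admissible Omega eps `*` admissible Omega eps) Psi.
Hypotheses (kP0 : kernel_on Omega P.1) (kP1 : kernel_on Omega P.2).
Hypothesis PsiP0 :
  {ae (leb \x leb)%E, forall z, (Omega `*` Omega) z -> Psi.1 z = P.1 z}.
Hypothesis PsiP1 :
  {ae (leb \x leb)%E, forall z, (Omega `*` Omega) z -> Psi.2 z = P.2 z}.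
Hypothesis P0nbhd : forall z, P.1 z != 0 -> nbhd Omega eps z.1 z.2.
Hypothesis P1nbhd : forall z, P.2 z != 0 -> nbhd Omega eps z.1 z.2.

Let F z := r0 z.1 * P.1 z - r1 z.1 * P.2 z.

(** The minus sign before the second kernel in [bracket] is absorbed by passing from [v] to its
    opposite, so both halves are fluxes of the same form. *)
Lemma pairingsE :
  grad_pairing Psi = (\int[leb \x leb]_z (flux eps v r0 P.1 z)%:E +
    \int[leb \x leb]_z (flux eps Nv r1 P.2 z)%:E)%E /\
  div_pairing Psi = grad_pairing Psi.
Proof.
have [[iPsi0 _ _] [iPsi1 _ _]] := adm.
have mPsi0 : measurable_fun (Omega `*` Omega) Psi.1.
  by apply/measurable_EFinP; exact: measurable_int iPsi0.
have mPsi1 : measurable_fun (Omega `*` Omega) Psi.2.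
  by apply/measurable_EFinP; exact: measurable_int iPsi1.
have mfst (rho : T -> R) : measurable_fun Omega rho ->
    measurable_fun (Omega `*` Omega) (fun z => rho z.1).
  move=> mrho; apply: (measurable_comp mO _ mrho) => [_ [z [? _] <-]|]//.
  exact: measurable_funTS.
have mf : measurable_fun (Omega `*` Omega) (bracket Psi (rho0, rho1)).
  by apply: measurable_funB; apply: measurable_funM => //; exact: mfst.
have iF : (leb \x leb)%E.-integrable setT (EFin \o F).
  rewrite (_ : _ \o _ = (fun z => (r0 z.1 * P.1 z)%:E - (r1 z.1 * P.2 z)%:E)%E)//.
  apply: integrableB => //.
    exact: integrable_kernel kP0 ir0 r0O.
  exact: integrable_kernel kP1 ir1 r1O.
have fF : {ae (leb \x leb)%E, forall z, (Omega `*` Omega) z ->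
    bracket Psi (rho0, rho1) z = F z}.
  have a0 := @ae_fst _ _ _ _ _ leb leb _ rho0E.
  have a1 := @ae_fst _ _ _ _ _ leb leb _ rho1E.
  apply: filterS (filterI (filterI a0 a1) (filterI PsiP0 PsiP1)) => z.
  move=> [[z0 z1] [zP0 zP1]] zO; rewrite /bracket/= zP0// zP1//.
  by rewrite z0 ?z1; [rewrite /F [P.1 z * _]mulrC [P.2 z * _]mulrC|case: zO..].
have Fnbhd z : F z != 0 -> Omega z.1 /\ nbhd Omega eps z.1 z.2.
  move=> Fz; split.
    by apply: contrapT => nO; move: Fz; rewrite /F r0O// r1O// !mul0r subr0 eqxx.
  have [P0|/P0nbhd//] := eqVneq (P.1 z) 0; apply: P1nbhd.
  by apply: contra_neq Fz => P1; rewrite /F P0 P1 !mulr0 subr0.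
have gradE := grad_pairingE oO eps0 mu mv vM uv mf iF fF Fnbhd.
split.
  rewrite /grad_pairing gradE -integralD//; last 2 first.
  - exact (integrable_flux eps mv vM r0_ge0 r0O ir0 kP0).
  - exact (integrable_flux eps mNv NvM r1_ge0 r1O ir1 kP1).
  apply: eq_integral => z _; rewrite -EFinD /flux; congr EFin.
  rewrite /F mulrBr [r0 _ * _]mulrC [r1 _ * _]mulrC; congr (_ + _).
  by rewrite -mulNr -mulNr opprB; congr (_ / _ * _); rewrite opprK addrC.
by rewrite /div_pairing (div_pairingE oO eps0 mu mv vM uv mf iF fF Fnbhd).
Qed.

End pairing_values.

(** This is the set [K] given to [admissible_kernel]. The bound is imposed only for first points in
    [Omega], where [esup] is known to be measurable. *)
Lemma measurable_le_esup (w : T -> R) : measurable_fun setT w ->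
  (forall x, `|w x| <= M) ->
  measurable ([set z : T * T | nbhd Omega eps z.1 z.2] `&`
    ~` ([set z | Omega z.1] `&` [set z | esup Omega eps w z.1 < w z.2])).
Proof.
move=> mw wM; apply: measurableI; first exact: measurable_nbhd_graph.
apply: measurableC.
have -> : [set z | Omega z.1] `&` [set z | esup Omega eps w z.1 < w z.2] =
    (Omega `*` setT) `&` [set z | (esup Omega eps w \_ Omega) z.1 - 0 < w z.2].
  apply/seteqP; split => z /=; rewrite subr0.
    by move=> [Oz lt_z]; split => //; rewrite patchE mem_set.
  by move=> [[Oz _]]; rewrite patchE mem_set.
apply: measurableI; first exact: measurableX.
exact (measurable_below_esup oO eps0 mw wM 0).
Qed.

(** By [esup_ub] the bound fails only on null sets of sections, so a representative can satisfy it
    wherever it is nonzero, as [flux_le] requires. *)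
Lemma clean_kernel (w : T -> R) (Psi : T * T -> R) : measurable_fun setT w ->
  (forall x, `|w x| <= M) -> admissible Omega eps Psi ->
  exists P, [/\ kernel_on Omega P,
    {ae (leb \x leb)%E, forall z, (Omega `*` Omega) z -> Psi z = P z},
    forall z, P z != 0 -> nbhd Omega eps z.1 z.2 &
    forall z, P z != 0 -> w z.2 <= esup Omega eps w z.1].
Proof.
move=> mw wM aPsi.
have [|P [kP PsiP PK]] := admissible_kernel oO eps0 aPsi (measurable_le_esup mw wM).
  move=> x Ox; apply: filterS (esup_ub oO eps0 wM Ox) => y le_y xy; split => //=.
  by move=> [_]; apply/negP; rewrite -leNgt; exact: le_y.
exists P; split => // z Pz; first by have [] := PK z Pz.
rewrite leNgt; apply/negP => lt_z; have [_] := PK z Pz; apply; split => //=.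
have [_ _ POO _] := kP; apply: contrapT => nz; move/eqP: Pz; apply.
by apply: POO => -[].
Qed.

Lemma grad_pairing_le Psi :
  (admissible Omega eps `*` admissible Omega eps) Psi ->
  (grad_pairing Psi <= V0 + V1)%E /\ div_pairing Psi = grad_pairing Psi.
Proof.
move=> adm; have [adm0 adm1] := adm.
have [P0 [kP0 PsiP0 P0nbhd P0le]] := clean_kernel mv vM adm0.
have [P1 [kP1 PsiP1 P1nbhd P1le]] := clean_kernel mNv NvM adm1.
have [-> ->] := @pairingsE Psi (P0, P1) adm kP0 kP1 PsiP0 PsiP1 P0nbhd P1nbhd.
split => //; apply: leeD.
  exact (flux_le oO eps0 mv vM r0_ge0 r0O ir0 kP0 P0le).
exact (flux_le oO eps0 mNv NvM r1_ge0 r1O ir1 kP1 P1le).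
Qed.

Lemma grad_pairing_ge (e : R) : 0 < e -> exists2 Psi,
  (admissible Omega eps `*` admissible Omega eps) Psi &
  (V0 + V1 <= grad_pairing Psi + e%:E)%E.
Proof.
move=> e0.
have fin0 : (\int[leb]_x (r0 x)%:E)%E \is a fin_num by exact: integrable_fin_num ir0.
have fin1 : (\int[leb]_x (r1 x)%:E)%E \is a fin_num by exact: integrable_fin_num ir1.
pose I0 := fine (\int[leb]_x (r0 x)%:E)%E; pose I1 := fine (\int[leb]_x (r1 x)%:E)%E.
have I00 : 0 <= I0 by apply/fine_ge0/integral_ge0 => x _; rewrite lee_fin.
have I10 : 0 <= I1 by apply/fine_ge0/integral_ge0 => x _; rewrite lee_fin.
(* The two errors then add up to at most [e]; the summand 1 keeps the denominator positive even if
   both integrals vanish. *)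
pose k := e * eps / (I0 + I1 + 1).
have I1_gt0 : 0 < I0 + I1 + 1 by rewrite ltr_wpDl// addr_ge0.
have k0 : 0 < k by rewrite divr_gt0// mulr_gt0.
have [P0 [adm0 kP0 P0nbhd P0ge]] := near_optimal_kernel oO bO eps0 mv vM k0.
have [P1 [adm1 kP1 P1nbhd P1ge]] := near_optimal_kernel oO bO eps0 mNv NvM k0.
exists (P0, P1) => //.
(* The near-optimal kernels are their own representatives. *)
have [|||||||-> _] := @pairingsE (P0, P1) (P0, P1) => //; try by apply: aeW.
have := flux_ge oO eps0 mv vM r0_ge0 r0O ir0 kP0 P0ge.
have := flux_ge oO eps0 mNv NvM r1_ge0 r1O ir1 kP1 P1ge.
rewrite -(fineK fin0) -(fineK fin1) -/I0 -/I1.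
(* All quantities are finite, so the comparison becomes one between real numbers. *)
have /fineK <- : V0 \is a fin_num.
  exact/integrable_fin_num/(integrable_excess oO eps0 mv vM r0_ge0 ir0).
have /fineK <- : V1 \is a fin_num.
  exact/integrable_fin_num/(integrable_excess oO eps0 mNv NvM r1_ge0 ir1).
have /fineK <- : (\int[leb \x leb]_z (flux eps v r0 P0 z)%:E)%E \is a fin_num.
  exact/integrable_fin_num/(integrable_flux eps mv vM r0_ge0 r0O ir0 kP0).
have /fineK <- : (\int[leb \x leb]_z (flux eps Nv r1 P1 z)%:E)%E \is a fin_num.
  exact/integrable_fin_num/(integrable_flux eps mNv NvM r1_ge0 r1O ir1 kP1).
rewrite -!EFinM -!EFinB -!EFinD !lee_fin.
have ke : k / eps * I0 + k / eps * I1 <= e.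
  have -> : k / eps = e / (I0 + I1 + 1) by rewrite /k mulrAC mulfK// gt_eqF.
  rewrite -mulrDr mulrAC ler_pdivrMr//.
  by rewrite ler_pM2l// lerDl.
by move=> h1 h0; lra.
Qed.

Lemma duality :
  TV_eps Omega eps (rho0, rho1) u =
    ereal_sup [set grad_pairing Psi
              | Psi in admissible Omega eps `*` admissible Omega eps] /\
  TV_eps Omega eps (rho0, rho1) u =
    ereal_sup [set div_pairing Psi
              | Psi in admissible Omega eps `*` admissible Omega eps].
Proof.
(* The pairings agree for each [Psi], so both suprema run over the same set of values. *)
rewrite (_ : [set div_pairing Psi | Psi in _] = [set grad_pairing Psi
    | Psi in admissible Omega eps `*` admissible Omega eps]); last first.
  by apply: eq_imagel => Psi /grad_pairing_le[].
suff H : TV_eps Omega eps (rho0, rho1) u = ereal_sup [set grad_pairing Psi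
  | Psi in admissible Omega eps `*` admissible Omega eps] by split.
rewrite TV_epsE; apply/eqP; rewrite eq_le; apply/andP; split; last first.
  by apply: ge_ereal_sup => _ [Psi /grad_pairing_le[le_V _] <-].
apply/lee_addgt0Pr => e e0; have [Psi adm /le_trans] := grad_pairing_ge e0; apply.
by rewrite leeD2r//; apply: ereal_sup_ubound; exists Psi.
Qed.

End duality.

Unset Implicit Arguments.
Set Strict Implicit.

Theorem theorem4 (R : realType) (N : nat) (eps : R) (Omega : set 'rV[R]_N)
    (mu : probability ('rV[R]_N * bool)%type R)
    (rho0 rho1 : 'rV[R]_N -> R) (u : 'rV[R]_N -> R) :
  0 < eps ->
  domain Omega -> bounded_set Omega -> convex_set Omega ->
  mu (Omega `*` setT) = 1%E ->
  marginal mu false `<< lebesgue_rV N -> marginal mu true `<< lebesgue_rV N ->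
  is_density Omega (marginal mu false) rho0 ->
  is_density Omega (marginal mu true) rho1 ->
  Linfty Omega u ->
  TV_eps Omega eps (rho0, rho1) u =
    ereal_sup [set (\int[lebesgue_rV N]_(x in Omega)
                      \int[lebesgue_rV N]_(y in Omega)
                        (grad_eps eps u (x, y)
                           * bracket Psi (rho0, rho1) (x, y))%:E)%E
              | Psi in admissible Omega eps `*` admissible Omega eps]
  /\
  TV_eps Omega eps (rho0, rho1) u =
    ereal_sup [set (- \int[lebesgue_rV N]_(y in Omega)
                      ((u y)%:E
                         * div_eps Omega eps (bracket Psi (rho0, rho1)) y))%E
              | Psi in admissible Omega eps `*` admissible Omega eps].
Proof.
move=> eps0 [oO _ _] bO _ _ _ _ d0 d1 Lu.
have mO : measurable Omega by exact: open_measurable_rV.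
have [v [M [mv vM uv]]] := Linfty_repr mO Lu.
have nu0 i A : (0 <= marginal mu i A)%E by exact: measure_ge0.
have [r0 [r0_ge0 r0O ir0 rho0E]] := density_repr mO (nu0 false) d0.
have [r1 [r1_ge0 r1O ir1 rho1E]] := density_repr mO (nu0 true) d1.
have [[mu' _] [[i0 _] [i1 _]]] := (Lu, (d0, d1)).
have mrho0 : measurable_fun Omega rho0 by apply/measurable_EFinP; exact: measurable_int i0.
have mrho1 : measurable_fun Omega rho1 by apply/measurable_EFinP; exact: measurable_int i1.
exact: (duality oO bO eps0 mu' mv vM uv mrho0 mrho1 r0_ge0
  r1_ge0 r0O r1O ir0 ir1 rho0E rho1E).
Qed.
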